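(* Let $P_1(z)$ and $P_2(z)$ be complex rational functions of degrees $n_1$ and $n_2$. Then $$\#\{z\in\mathbb{C} : |P_1(z)|=|P_2(z)|=1\}\le (n_1+n_2)^2,$$ unless $P_1=B_1\circ W$ and $P_2=B_2\circ W$ for some quotients of finite Blaschke products $B_1$, $B_2$ and some rational function $W$.
   Context: A finite Blaschke product is a rational function of the form $B(z)=\zeta\prod_{i=1}^n\left(\frac{z-a_i}{1-\bar a_i z}\right)^{m_i}$, where $a_1,\dots,a_n$ are complex numbers with $|a_i|<1$, the $m_i$ are positive integers, and $|\zeta|=1$. A quotient of finite Blaschke products is a rational function $Q=B/B'$ with $B,B'$ finite Blaschke products. *)

(* Defs.v *)
From HB Require Import structures.
From mathcomp Require Import all_boot all_order all_algebra.
From mathcomp Require Import complex.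
From mathcomp Require Import boolp classical_sets functions cardinality reals.

Set Implicit Arguments.
Unset Strict Implicit.
Unset Printing Implicit Defensive.
Import Order.TTheory GRing.Theory Num.Theory.
Local Open Scope ring_scope.
Local Open Scope quotient_scope.

Notation ratfun F := {fraction {poly F}}.
Notation "p %:F" := (@FracField.tofrac _ p) : ring_scope.

(* The representative chosen by [repr] need not be in lowest terms, hence the
   division by the gcd. The pair (ratnum P, ratden P) is coprime, and is
   determined by P up to a common nonzero constant. *)
Definition ratnum (F : fieldType) (P : ratfun F) : {poly F} :=
  \n_(repr P) %/ gcdp \n_(repr P) \d_(repr P).

Definition ratden (F : fieldType) (P : ratfun F) : {poly F} :=
  \d_(repr P) %/ gcdp \n_(repr P) \d_(repr P).

Definition ratdeg (F : fieldType) (P : ratfun F) : nat :=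
  maxn (size (ratnum P)).-1 (size (ratden P)).-1.

(* At a pole of P this is 0, since division by 0 yields 0; in particular a
   pole never satisfies [`|rateval P z| = 1]. *)
Definition rateval (F : fieldType) (P : ratfun F) (z : F) : F :=
  (ratnum P).[z] / (ratden P).[z].

Definition polycomp (F : fieldType) (p : {poly F}) (W : ratfun F) : ratfun F :=
  (map_poly (fun c : F => (c%:P)%:F) p).[W].

(* [is_ratcomp P B W] means P = B \o W. The first conjunct fails only if W is
   constant, equal to a pole of B; then B \o W is the constant infinity, which
   is not an element of the field of rational functions. *)
Definition is_ratcomp (F : fieldType) (P B W : ratfun F) : Prop :=
  polycomp (ratden B) W != 0 /\
  P = polycomp (ratnum B) W / polycomp (ratden B) W.

Definition blaschke_factor (R : realType) (a : R[i]) : ratfun R[i] :=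
  ('X - a%:P)%:F / (1 - (a^*)%C *: 'X)%:F.

Definition finite_blaschke (R : realType) (B : ratfun R[i]) : Prop :=
  exists (zeta : R[i]) (n : nat) (a : 'I_n -> R[i]) (m : 'I_n -> nat),
    [/\ `|zeta| = 1,
        forall i, `|a i| < 1,
        forall i, (0 < m i)%N &
        B = (zeta%:P)%:F * \prod_(i < n) blaschke_factor (a i) ^+ m i].

Definition blaschke_quotient (R : realType) (Q : ratfun R[i]) : Prop :=
  exists B B' : ratfun R[i],
    [/\ finite_blaschke B, finite_blaschke B' & Q = B / B'].

Lemma gcdp_repr_neq0 (F : fieldType) (P : ratfun F) :
  gcdp \n_(repr P) \d_(repr P) != 0.
Proof. by rewrite gcdp_eq0 negb_and denom_ratioP orbT. Qed.

Lemma ratden_neq0 (F : fieldType) (P : ratfun F) : ratden P != 0.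
Proof.
apply/eqP => d0; have := denom_ratioP (repr P).
by rewrite -(divpK (dvdp_gcdr \n_(repr P) \d_(repr P))) -/(ratden P) d0 mul0r eqxx.
Qed.

Lemma coprimep_ratnum_ratden (F : fieldType) (P : ratfun F) :
  coprimep (ratnum P) (ratden P).
Proof. by apply: coprimep_div_gcd; rewrite denom_ratioP orbT. Qed.

Lemma fraction_reprE (F : fieldType) (P : ratfun F) :
  P = (\n_(repr P))%:F / (\d_(repr P))%:F.
Proof.
have d0 := denom_ratioP (repr P).
have dF0 : (\d_(repr P))%:F != 0 by rewrite tofrac_eq0.
apply: (mulIf dF0); rewrite mulfVK // -{1}[P]reprK.
unlock FracField.tofrac; rewrite -[LHS]FracField.pi_mul.
apply/eqmodP => /=; rewrite FracField.equivfE /= /FracField.mulf.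
by rewrite !numden_Ratio ?mulf_neq0 ?oner_neq0 // !mulr1 mulrC.
Qed.

Lemma ratfunE (F : fieldType) (P : ratfun F) :
  P = (ratnum P)%:F / (ratden P)%:F.
Proof.
set g := gcdp \n_(repr P) \d_(repr P).
have nE : \n_(repr P) = ratnum P * g by rewrite divpK ?dvdp_gcdl.
have dE : \d_(repr P) = ratden P * g by rewrite divpK ?dvdp_gcdr.
rewrite {1}[P]fraction_reprE nE dE !tofracM -mulf_div divff ?mulr1 //.
by rewrite tofrac_eq0 gcdp_repr_neq0.
Qed.

Lemma ratnum_ratden_frac (F : fieldType) (p q : {poly F}) :
  q != 0 -> coprimep p q ->
  exists2 c : F, c != 0 &
    ratnum (p%:F / q%:F) = c *: p /\ ratden (p%:F / q%:F) = c *: q.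
Proof.
move=> q0 cpq; set P := p%:F / q%:F.
have d0 := ratden_neq0 P; have cP := coprimep_ratnum_ratden P.
have E : p * ratden P = ratnum P * q.
  apply/eqP; rewrite -tofrac_eq !tofracM -eqr_div ?tofrac_eq0 //.
  by rewrite -ratfunE.
have qd : q %| ratden P.
  by rewrite -(@Gauss_dvdpr _ (ratden P) p q) 1?coprimep_sym // E dvdp_mull.
have dq : ratden P %| q.
  by rewrite -(@Gauss_dvdpr _ q (ratnum P) (ratden P)) 1?coprimep_sym // -E dvdp_mull.
have /eqpf_eq[c c0 dE] : ratden P %= q by rewrite /eqp dq qd.
exists c => //; split=> //.
by apply: (mulIf q0); rewrite -E dE -scalerAr -scalerAl.
Qed.

Lemma ratdeg_frac (F : fieldType) (p q : {poly F}) :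
  q != 0 -> coprimep p q ->
  ratdeg (p%:F / q%:F) = maxn (size p).-1 (size q).-1.
Proof.
move=> q0 /(ratnum_ratden_frac q0)[c c0 [nE dE]].
by rewrite /ratdeg nE dE !size_scale.
Qed.

Lemma rateval_frac (F : fieldType) (p q : {poly F}) (z : F) :
  q != 0 -> coprimep p q -> rateval (p%:F / q%:F) z = p.[z] / q.[z].
Proof.
move=> q0 /(ratnum_ratden_frac q0)[c c0 [nE dE]].
by rewrite /rateval nE dE !hornerZ -mulf_div divff // mul1r.
Qed.

(* Main.v *)
Require Import Defs.
From mathcomp Require Import all_boot all_order all_algebra all_fingroup.
From mathcomp Require Import complex polyXY polyrcf.
From mathcomp Require Import boolp classical_sets functions cardinality reals.
From mathcomp Require Import zify ring lra.

(* Write P_i = p_i/q_i and let F_i(z,w) = p_i(z) p_i*(w) - q_i(z) q_i*(w), where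
   * conjugates coefficients. The points to count are the z with
   F_1(z, conj z) = F_2(z, conj z) = 0.

   If they are Zariski dense in the line, the field S of the rational functions f
   whose conjugate agrees with a rational function along the set contains P_1 and
   P_2, so S = C(W) by Lueroth. Conjugation along the set is a semilinear
   involution of C(W), given on W by a Moebius transformation, and another
   Moebius transformation turns W into a generator V of modulus 1 along the set.
   Then P_i = B_i(V) with |B_i| = 1 at infinitely many points of the unit circle,
   so the zeros and poles of B_i come in pairs b, 1/conj b.

   Otherwise they are finite in number. When F_1 and F_2 are coprime, the
   resultant with respect to w bounds this number, because distinct points have
   distinct first coordinates. A common factor D with finitely many zeros
   (z, conj z) either is coprime to its reflection, or is real up to a constant;
   in the latter case it has constant sign on the plane, so dD/dw vanishes at its
   zeros as well. Measuring polynomials by the sum of the two partial degrees makes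
   all these bounds multiplicative, and F_i has measure at most 2 n_i. *)

Set Implicit Arguments.
Unset Strict Implicit.
Unset Printing Implicit Defensive.
Import Order.TTheory GRing.Theory Num.Theory.
Local Open Scope ring_scope.

(** * Bivariate polynomials: Gauss's lemma and resultants *)

Section Gauss.
Variable F : closedFieldType.
Implicit Types (C D N : {poly {poly F}}) (k : {poly F}) (c : F).

(** Over an algebraically closed field the coefficients are coprime exactly when they have no common
    root. *)
Definition primitive C := forall c, map_poly (horner_eval c) C != 0.

Lemma inner_factor c D :
  map_poly (horner_eval c) D = 0 -> exists D', D = ('X - c%:P)%:P * D'.
Proof.
rewrite -horner_swapXY => /rootP/factor_theorem[q Eq].
exists (swapXY q); rewrite -[LHS]swapXYK Eq rmorphM mulrC; congr (_ * _).
by rewrite rmorphB /= swapXY_X swapXY_polyC map_polyC -polyCB.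
Qed.

Lemma nonconst_root k : (1 < size k)%N -> exists c, root k c.
Proof. by move=> k1; apply/closed_rootP; rewrite gtn_eqF. Qed.

(** Each root [c] of [k] can be cancelled: at the inner value [c] the product [C * N] vanishes while
    [C] does not, so [N] is divisible by X - c. *)
Lemma gauss_primitive C D N k : primitive C -> k != 0 ->
  k%:P * D = C * N -> exists N', D = C * N'.
Proof.
move=> primC; elim: (size k) {-2}k (leqnn (size k)) N => [|m IH] {}k lek N k0 E.
  by rewrite leqn0 size_poly_eq0 (negPf k0) in lek.
have [k1|/nonconst_root[c rc]] := leqP (size k) 1.
  have /size_poly1P[a a0 ka] : size k == 1%N by rewrite eqn_leq k1 size_poly_gt0.
  exists (a^-1%:P%:P * N); rewrite mulrCA -E ka mulrA -!polyCM mulVf //.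
  by rewrite mul1r.
have [k' Ek] := factor_theorem _ _ rc.
have /eqP : map_poly (horner_eval c) (C * N) = 0.
  by rewrite -E rmorphM /= map_polyC /= /horner_eval (rootP rc) mul0r.
rewrite rmorphM mulf_eq0 (negPf (primC c)) /= => /eqP/inner_factor[N' EN].
have k'0 : k' != 0 by apply: contraNneq k0 => k'0; rewrite Ek k'0 mul0r.
have Xc0 : ('X - c%:P)%:P != 0 :> {poly {poly F}}.
  by rewrite polyC_eq0 polyXsubC_eq0.
apply: (IH k' _ N' k'0).
  by move: lek; rewrite Ek size_Mmonic ?monicXsubC // size_XsubC addn2.
apply: (mulfI Xc0); rewrite mulrA -polyCM [_ * k']mulrC -Ek E EN; ring.
Qed.

(** Removing inner linear factors terminates because each lowers the degree of the leading
    coefficient. *)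
Lemma primitive_part D : D != 0 ->
  exists k C, [/\ k != 0, primitive C & D = k%:P * C].
Proof.
elim: (size (lead_coef D)) {-2}D (leqnn (size (lead_coef D))) => [|m IH] {}D.
  by rewrite leqn0 size_poly_eq0 lead_coef_eq0 => /eqP-> /eqP.
move=> leD D0; have [prim|] := pselect (primitive D).
  by exists 1, D; split; rewrite ?oner_neq0 ?mul1r.
move=> /existsNP[c /negP/negPn/eqP/inner_factor[D' ED]].
have D'0 : D' != 0 by apply: contraNneq D0 => D'0; rewrite ED D'0 mulr0.
have [|k [C [k0 pC EC]]] := IH D' _ D'0.
  move: leD; rewrite ED lead_coefM lead_coefC mulrC.
  by rewrite size_Mmonic ?lead_coef_eq0 ?monicXsubC // size_XsubC addn2.
exists (('X - c%:P) * k), C; split => //.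
  by rewrite mulf_neq0 // polyXsubC_eq0.
by rewrite ED EC polyCM mulrA.
Qed.

(** Over the ring of inner polynomials [gcdp] divides only up to a factor from that ring; for the
    primitive part of the gcd, Gauss's lemma removes this factor. *)
Lemma common_factor D N : D != 0 -> (1 < size (gcdp D N))%N ->
  exists C D' N', [/\ (1 < size C)%N, D = C * D' & N = C * N'].
Proof.
move=> D0 g1; have g0 : gcdp D N != 0 by rewrite gcdp_eq0 (negPf D0).
have [k [C [k0 pC Eg]]] := primitive_part g0.
have factor P : gcdp D N %| P -> exists P', P = C * P'.
  move=> /Pdiv.Idomain.dvdpP[[a q] /= a0 Eq].
  apply: (@gauss_primitive C P (k%:P * q) a pC a0).
  by rewrite mul_polyC Eq Eg; ring.
have [D' ED] := factor D (dvdp_gcdl _ _).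
have [N' EN] := factor N (dvdp_gcdr _ _).
exists C, D', N'; split => //.
by move: g1; rewrite Eg mul_polyC size_scale.
Qed.

End Gauss.

(** Every term of the Leibniz expansion takes one entry from each row, so the row bounds add up. *)
Lemma size_det (F : idomainType) n (A : 'M[{poly F}]_n) (d : 'I_n -> nat) :
  (forall i j, (size (A i j) <= (d i).+1)%N) ->
  (size (\det A) <= (\sum_i d i).+1)%N.
Proof.
move=> Ad; rewrite /determinant; apply: (leq_trans (size_sum _ _ _)).
apply/bigmax_leqP => s _; rewrite size_Msign.
have [->|prod0] := eqVneq (\prod_i A i (s i)) 0; first by rewrite size_poly0.
rewrite size_prod; last first.
  by move=> i _; move: prod0; rewrite (bigD1 i) //= mulf_eq0 negb_or => /andP[].
rewrite leq_subLR addnS ltnS -sum1_card -big_split /=.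
by apply: leq_sum => i _; rewrite add1n.
Qed.

Lemma size_resultant (F : idomainType) (D N : {poly {poly F}}) :
  (size (resultant D N) <=
     ((size N).-1 * (sizeY D).-1 + (size D).-1 * (sizeY N).-1).+1)%N.
Proof.
have le_coef (P : {poly {poly F}}) k b : (size (P`_k *+ (b : bool)) <= (sizeY P).-1.+1)%N.
  rewrite mulrb; case: b => /=; last by rewrite size_poly0.
  by apply: leq_trans (max_size_coefXY P k) _; rewrite leqSpred.
pose d (i : 'I_((size N).-1 + (size D).-1)) :=
  match fintype.split i with inl _ => (sizeY D).-1 | inr _ => (sizeY N).-1 end.
have := @size_det _ _ (Sylvester_mx D N) d.
move=> /(_ _)/leq_trans; apply.
  by move=> i j; rewrite Sylvester_mxE /d; case: (fintype.split i) => k; apply: le_coef.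
rewrite ltnS big_split_ord /= leq_add //.
  rewrite (eq_bigr (fun=> (sizeY D).-1)) ?sum_nat_const ?card_ord // => i _.
  by rewrite /d (unsplitK (inl i)).
rewrite (eq_bigr (fun=> (sizeY N).-1)) ?sum_nat_const ?card_ord // => i _.
by rewrite /d (unsplitK (inr i)).
Qed.

(** This measure is additive on products and symmetric in the two variables, and the product of two
    such values dominates the bound of [size_resultant]. *)
Definition bideg (F : nzRingType) (D : {poly {poly F}}) :=
  ((size D).-1 + (sizeY D).-1)%N.

Lemma bidegM (F : idomainType) (D N : {poly {poly F}}) :
  D != 0 -> N != 0 -> bideg (D * N) = (bideg D + bideg N)%N.
Proof.
move=> D0 N0; rewrite /bideg !sizeYE rmorphM !size_mul ?swapXY_eq0 //=.
have pos (P : {poly {poly F}}) : P != 0 -> (0 < size P)%N by rewrite size_poly_gt0.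
have := pos _ D0; have := pos _ N0.
have := pos (swapXY D); have := pos (swapXY N); rewrite !swapXY_eq0.
move=> /(_ N0) + /(_ D0).
move: (size D) (size N) (size (swapXY D)) (size (swapXY N)); lia.
Qed.

Lemma size_le1_inner (F : nzRingType) (D : {poly {poly F}}) : (size D <= 1)%N ->
  D = (D`_0)%:P /\ size D`_0 = sizeY D.
Proof.
by move=> /size1_polyC DE; split; rewrite // [in RHS]DE sizeYE swapXY_polyC size_map_polyC.
Qed.

(** * Common zeros on the plane and the reflection [starp] *)

Section PlaneZero.
Variable F : numClosedFieldType.
Implicit Types (C D N : {poly {poly F}}) (z : F) (s : seq F).

(* A bivariate polynomial is read on the plane by putting the outer variable
   equal to the conjugate of the inner one. *)
Definition planezero D z := D.[z^*, z] == 0.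

(** The swap puts the conjugated coefficients back on the plane: there the values of [starp D] are
    the conjugates of those of [D]. *)
Definition starp D := swapXY (map_poly (map_poly (@Num.conj F)) D).

Lemma planezeroM D N z : planezero (D * N) z = planezero D z || planezero N z.
Proof. by rewrite /planezero !hornerM mulf_eq0. Qed.

Lemma planezero_size_le1 D s : D != 0 -> (size D <= 1)%N ->
  uniq s -> all (planezero D) s -> (size s <= bideg D)%N.
Proof.
move=> D0 /[dup] sD /size_le1_inner[ED sE] us sz.
have d0 : D`_0 != 0 by rewrite -polyC_eq0 -ED.
have : (size s < size (D`_0)%R)%N.
  apply: max_poly_roots => //; apply/allP => z /(allP sz).
  by rewrite /planezero {1}ED hornerC.
have : (0 < size D)%N by rewrite size_poly_gt0.
by rewrite /bideg sE; lia.
Qed.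

(** If the gcd has outer degree 0, the resultant is a nonzero polynomial in the inner variable. It
    lies in the ideal of [D] and [N], so every common zero z is a root of it. *)
Lemma few_common_or_factor D N : D != 0 -> N != 0 -> (1 < size D)%N ->
  (forall s, uniq s -> all (planezero D) s -> all (planezero N) s ->
     (size s <= bideg D * bideg N)%N) \/
  (exists C D' N', [/\ (1 < size C)%N, D = C * D' & N = C * N']).
Proof.
move=> D0 N0 sD; have [sN|sN] := leqP (size N) 1.
  left=> s us _ /(planezero_size_le1 N0 sN us)/leq_trans; apply.
  by rewrite leq_pmull // addn_gt0 -subn1 subn_gt0 sD.
have [/(common_factor D0)|] := boolP (1 < size (gcdp D N))%N; first by right.
rewrite -resultant_eq0 => res0; left=> s us sz1 sz2.
have [[u v] _ /= E] := resultant_in_ideal sD sN.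
have : (size s < size (resultant D N))%N.
  apply: max_poly_roots => //; apply/allP => z zs; apply/rootP.
  rewrite -(hornerC (resultant D N) (z^*)%:P) E !hornerE.
  by rewrite (eqP (allP sz1 _ zs)) (eqP (allP sz2 _ zs)) !mulr0 addr0.
move=> /leq_trans/(_ (size_resultant D N)); rewrite ltnS => /leq_trans; apply.
rewrite /bideg; move: (size D).-1 (size N).-1 (sizeY D).-1 (sizeY N).-1 => a b c d; nia.
Qed.

Lemma horner_starp D z : (starp D).[z^*, z] = (D.[z^*, z])^*.
Proof.
have Ez : z%:P = map_poly Num.conj (z^*)%:P by rewrite map_polyC /= conjCK.
by rewrite horner2_swapXY Ez !horner_map.
Qed.

Lemma starpK : involutive starp.
Proof.
move=> D; apply/polyP => i; apply/polyP => j.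
by rewrite !(coef_swapXY, coef_map) /= conjCK.
Qed.

Lemma size_starp D : size (starp D) = sizeY D.
Proof.
rewrite sizeYE /starp swapXY_map size_map_inj_poly ?rmorph0 //.
by apply: map_inj_poly; [exact: (inv_inj conjCK) | exact: rmorph0].
Qed.

Lemma sizeY_starp D : sizeY (starp D) = size D.
Proof. by rewrite -{2}[D]starpK size_starp. Qed.

Lemma bideg_starp D : bideg (starp D) = bideg D.
Proof. by rewrite /bideg size_starp sizeY_starp addnC. Qed.

Lemma planezero_starp D : planezero (starp D) =1 planezero D.
Proof. by move=> z; rewrite /planezero horner_starp conjC_eq0. Qed.

Lemma starp_eq0 D : (starp D == 0) = (D == 0).
Proof. by rewrite -size_poly_eq0 size_starp sizeY_eq0. Qed.

Lemma bideg0 D : bideg D = 0%N -> D = ((D`_0)`_0)%:P%:P.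
Proof.
move=> /eqP; rewrite addn_eq0 => /andP[sD sY].
have /size_le1_inner[ED sE] : (size D <= 1)%N by move: sD; case: (size D) => [|[]].
by rewrite {1}ED; congr _%:P; apply: size1_polyC; rewrite sE; move: sY; case: (sizeY D) => [|[]].
Qed.

End PlaneZero.

(** * Real bivariate polynomials with finitely many zeros *)

Lemma poly_nat_roots0 (F : numDomainType) (h : {poly F}) :
  (forall n : nat, h.[n%:R] = 0) -> h = 0.
Proof.
move=> h0; apply/eqP; apply: contraT => hN0.
have /(_ [seq n%:R | n <- iota 0 (size h)]) := @max_poly_roots _ h _ hN0.
rewrite size_map size_iota ltnn map_inj_uniq ?iota_uniq; last first.
  by move=> m n /eqP; rewrite eqr_nat => /eqP.
by apply=> //; apply/allP => _ /mapP[n _ ->]; apply/rootP.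
Qed.

(** * Restriction to parametrised curves *)

Section LineRestriction.
Variable F : comNzRingType.
Implicit Types (D : {poly {poly F}}) (p q : {poly F}).

Definition biline p q D := (map_poly (comp_poly p) D).[q].

Lemma bilineMXaddC p q D c :
  biline p q (D * 'X + c%:P) = biline p q D * q + (c \Po p).
Proof.
by rewrite /biline rmorphD rmorphM /= map_polyX map_polyC hornerMXaddC.
Qed.

Lemma biline0 p q : biline p q 0 = 0.
Proof. by rewrite /biline rmorph0 horner0. Qed.

Lemma horner_biline p q D t : (biline p q D).[t] = D.[q.[t], p.[t]].
Proof.
elim/poly_ind: D => [|D c IH]; first by rewrite biline0 !horner0.
by rewrite bilineMXaddC !hornerE IH horner_comp.
Qed.

(** Chain rule; the coefficientwise derivative is the partial derivative in the inner variable. *)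
Lemma deriv_biline p q D :
  (biline p q D)^`() =
  biline p q (map_poly (@deriv F) D) * p^`() + biline p q D^`() * q^`().
Proof.
elim/poly_ind: D => [|D c IH].
  by rewrite !(biline0, map_poly0, deriv0) !mul0r addr0.
have -> : map_poly (@deriv F) (D * 'X + c%:P) =
    map_poly (@deriv F) D * 'X + (c^`())%:P.
  apply/polyP => i; rewrite !(coef_map, coefD, coefMX, coefC) /= derivD.
  by case: i => [|i] /=; rewrite ?deriv0 // coef_map.
rewrite derivD derivM derivX derivC addr0 mulr1 !bilineMXaddC.
have -> : biline p q (D^`() * 'X + D) = biline p q D^`() * q + biline p q D.
  by rewrite /biline rmorphD rmorphM /= map_polyX hornerD hornerMX.
rewrite derivD derivM IH deriv_comp; ring.
Qed.

End LineRestriction.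

(** * Sign of a polynomial that is real on the plane *)

Section Sign.
Variable R : rcfType.
Local Notation C := R[i].
Local Notation rc := (real_complex R).
Implicit Types (D : {poly {poly C}}) (z A B : C).

Lemma conjC_rc (x : R) : (rc x)^* = rc x.
Proof. exact: conjc_real. Qed.

Definition plane_real D := forall z, (D.[z^*, z])^* = D.[z^*, z].

(** The restriction to the line A + Bt is real at every natural number t, so it agrees with its
    conjugate polynomial. *)
Lemma real_poly_line D A B : plane_real D ->
  exists g : {poly R}, map_poly rc g
     = biline (A%:P + B *: 'X) (A^*%:P + B^* *: 'X) D.
Proof.
move=> rD; set gc := biline _ _ _.
have gcE t : gc.[(rc t)] = D.[(A + B * rc t)^*, A + B * (rc t)].
  have -> : (A + B * rc t)^* = A^* + B^* * rc t by rewrite rmorphD rmorphM /= conjC_rc.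
  by rewrite horner_biline !hornerE.
have gc_real : map_poly Num.conj gc = gc.
  apply/eqP; rewrite -subr_eq0; apply/eqP/poly_nat_roots0 => n.
  have -> : n%:R = rc n%:R by rewrite rmorph_nat.
  rewrite hornerD hornerN -{1}(conjC_rc n%:R).
  by rewrite (horner_map Num.conj) gcE /= rD subrr.
exists (map_poly (@complex.Re R) gc); apply/polyP => i.
rewrite coef_map coef_map_id0 //=; apply: RRe_real.
by rewrite CrealE -{2}gc_real coef_map.
Qed.

Lemma plane_real_rc D z : plane_real D -> D.[z^*, z] = rc (complex.Re D.[z^*, z]).
Proof. by move=> rD; rewrite RRe_real // CrealE rD. Qed.

Lemma horner_line D A B (g : {poly R}) t :
  map_poly rc g = biline (A%:P + B *: 'X) (A^*%:P + B^* *: 'X) D ->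
  rc g.[t] = D.[(A + B * rc t)^*, A + B * rc t].
Proof.
move=> Eg; rewrite -horner_map /= Eg horner_biline !hornerE.
by congr D.[_%:P].[_]; rewrite rmorphD rmorphM /= conjC_rc.
Qed.

Local Notation val D z := (complex.Re D.[z^*, z]).

(** On a segment the intermediate value theorem for real polynomials applies. The zero differs from
    [A], whence the strict bound on [t]. *)
Lemma plane_ivt D A B : plane_real D -> val D A != 0 -> val D A * val D B <= 0 ->
  exists t : R, [/\ 0 < t, t <= 1 & planezero D (A + (B - A) * rc t)].
Proof.
move=> rD A0 AB.
have [g /horner_line Eg] := real_poly_line A (B - A) rD.
have g0 : g.[0] = val D A by rewrite -[LHS]/(complex.Re (rc _)) Eg rmorph0 mulr0 addr0.
have g1 : g.[1] = val D B.
  by rewrite -[LHS]/(complex.Re (rc _)) Eg rmorph1 mulr1 addrC subrK.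
have zero t : 0 <= t <= 1 -> root g t ->
    exists t : R, [/\ 0 < t, t <= 1 & planezero D (A + (B - A) * rc t)].
  move=> /andP[t0 t1] /rootP gt; exists t; split => //; last first.
    by rewrite /planezero -Eg gt rmorph0.
  rewrite lt_def t0 andbT; apply: contraNneq A0 => t00.
  by rewrite t00 g0 in gt; rewrite gt.
have [A_neg|A_pos] := ltP (val D A) 0.
  have [|t t01 rt] := @poly_ivt R g 0 1 ler01; last exact: zero rt.
  by rewrite g0 g1 (ltW A_neg) /=; rewrite nmulr_rle0 in AB.
have [|t t01 rt] := @poly_ivt R (- g) 0 1 ler01.
  rewrite !hornerN g0 g1 oppr_le0 A_pos oppr_ge0 /=.
  by rewrite pmulr_rle0 // lt_def A0 in AB.
by rewrite rootN in rt; apply: zero rt.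
Qed.

Lemma no_sign_change D (k : {poly C}) A B : plane_real D -> k != 0 ->
  (forall z, planezero D z -> root k z) -> 0 <= val D A * val D B.
Proof.
move=> rD k0 zk; rewrite leNgt; apply/negP => AB.
have [A0 B0] : val D A != 0 /\ val D B != 0.
  by apply/andP; rewrite -negb_or -mulf_eq0 lt_eqF.
have AB' : B - A != 0.
  apply: contraTneq AB => /eqP; rewrite subr_eq0 => /eqP ->.
  by rewrite -leNgt -expr2 sqr_ge0.
(* Through the points of the perpendicular bisector of A and B run infinitely
   many paths from A to B that meet only at A and B. *)
have zero_on n : exists x : R, 0 < 1 - `|2 * x - 1| /\
    planezero D (A + (B - A) * (x +i* (n%:R * (1 - `|2 * x - 1|)))%C).
  (* In the coordinate with [A] at 0 and [B] at 1, the path through [M] is the tent y = n(1 - |2x -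
     1|), with apex 1/2 + ni. *)
  pose M := A + (B - A) * (2^-1 +i* n%:R)%C.
  have [AM|AM] := leP (val D A * val D M) 0.
    have [t [t0 t1 zt]] := plane_ivt rD A0 AM.
    exists (t / 2); have -> : `|2 * (t / 2) - 1| = 1 - t.
      by rewrite ler0_norm; lra.
    split; first lra.
    suff <- : A + (M - A) * rc t = A + (B - A) *
      (t / 2 +i* (n%:R * (1 - (1 - t))))%C by [].
    rewrite /M addrAC subrr add0r -mulrA; congr (_ + _ * _).
    apply/eqP; rewrite eq_complex /=; apply/andP; split; apply/eqP; ring.
  have BM : val D B * val D M <= 0.
    have /ltW : (val D A * val D B) * (val D A * val D M) < 0 by rewrite pmulr_llt0.
    by rewrite mulrACA -expr2 pmulr_rle0 // exprn_even_gt0.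
  have [t [t0 t1 zt]] := plane_ivt rD B0 BM.
  exists (1 - t / 2); have -> : `|2 * (1 - t / 2) - 1| = 1 - t.
    by rewrite ger0_norm; lra.
  split; first lra.
  suff <- : B + (M - B) * rc t = A + (B - A) *
      ((1 - t / 2) +i* (n%:R * (1 - (1 - t))))%C by [].
  have -> : M - B = (B - A) * ((- 2^-1) +i* n%:R)%C.
    have -> : ((- 2^-1) +i* n%:R)%C = (2^-1 +i* n%:R)%C - 1 :> C.
      apply/eqP; rewrite eq_complex /=; apply/andP; split; apply/eqP; last ring.
      by field.
    by rewrite /M; ring.
  have -> : ((1 - t / 2) +i* (n%:R * (1 - (1 - t))))%C =
      1 + ((- 2^-1) +i* n%:R)%C * rc t.
    by apply/eqP; rewrite eq_complex /=; apply/andP; split; apply/eqP; ring.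
  ring.
have [x xP] := choice zero_on.
pose zn n := A + (B - A) * (x n +i* (n%:R * (1 - `|2 * x n - 1|)))%C.
have /(_ [seq zn n | n <- iota 0 (size k)]) := @max_poly_roots _ k _ k0.
rewrite size_map size_iota ltnn map_inj_uniq ?iota_uniq; last first.
  (* Points of two paths with the same x have the same positive factor 1 - |2x - 1|, so equal
     heights force m = n. *)
  move=> m n /addrI/(mulfI AB')/eqP; rewrite eq_complex /= => /andP[/eqP Ex].
  have [x0 _] := xP n; rewrite Ex => /eqP/(mulIf (lt0r_neq0 x0))/eqP.
  by rewrite eqr_nat => /eqP.
move=> contra; suff : false by []; apply: contra => //.
by apply/allP => _ /mapP[n _ ->]; apply: zk; case: (xP n).
Qed.

(** Write g = Xh. If h(0) were nonzero, h would keep its sign near 0 and g would change sign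
    there. *)
Lemma deriv0_of_semidefinite (g : {poly R}) : root g 0 ->
  (forall t u, 0 <= g.[t] * g.[u]) -> g^`().[0] = 0.
Proof.
move=> /factor_theorem[h Eg] pos; rewrite Eg subr0 derivM derivX !hornerE.
apply/eqP; apply: contraT => h0.
have [d d0 near0] : exists2 d : R, 0 < d &
    forall y : R, `|y - 0| < d -> `|h.[y] - h.[0]| < `|h.[0]|.
  by apply: poly_cont; rewrite normr_gt0.
have d2 : `|d / 2| < d by rewrite gtr0_norm; lra.
have a := near0 (d / 2); have b := near0 (- (d / 2)).
rewrite subr0 in a; rewrite subr0 normrN in b.
have p0 := pos (d / 2) (- (d / 2)); rewrite Eg subr0 !hornerMX in p0.
move: (a d2) (b d2) => {}a {}b.
exfalso; move: p0 a b h0; move: (h.[d / 2]) (h.[- (d / 2)]) (h.[0]) => a b c p0 + +.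
clear Eg pos near0 g h.
have d22 : 0 < d / 2 * (d / 2) by rewrite mulr_gt0; lra.
have ab : a * b <= 0.
  rewrite -(pmulr_lle0 _ d22).
  have -> : a * b * (d / 2 * (d / 2)) = - (a * (d / 2) * (b * - (d / 2))) by ring.
  by rewrite oppr_le0.
case: (ltgtP c 0) => // c0.
  rewrite !ltr_norml (ltr0_norm c0); nra.
rewrite !ltr_norml (gtr0_norm c0); nra.
Qed.

(** Since [D] has constant sign, the restriction to every line through a zero has a critical point
    at that zero. *)
Lemma planezero_deriv D (k : {poly C}) z : plane_real D -> k != 0 ->
  (forall z, planezero D z -> root k z) -> planezero D z -> planezero D^`() z.
Proof.
move=> rD k0 zk zD.
pose Dz := (map_poly (@deriv C) D).[z^*, z].
have critical B : Dz * B + D^`().[z^*, z] * B^* = 0.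
  have [g Eg] := real_poly_line z B rD.
  have Eg' := horner_line _ Eg.
  have g'0 : g^`().[0] = 0.
    apply: deriv0_of_semidefinite => [|t u].
      apply/rootP/(fmorph_inj rc); apply: etrans (Eg' 0) _.
      rewrite !rmorph0 mulr0 addr0.
      exact/eqP.
    have valg s : g.[s] = val D (z + B * rc s) by rewrite -Eg'.
    by rewrite !valg; apply: no_sign_change zk.
  have := congr1 rc g'0; rewrite -horner_map /= -deriv_map Eg deriv_biline.
  by rewrite rmorph0 !hornerE !horner_biline !derivE !hornerE /= !mulr1.
(* The directions 1 and i show that the sum and the difference of the two partial derivatives
   vanish. *)
have /eqP := critical 1; rewrite rmorph1 !mulr1 addr_eq0 => /eqP Dz0.
have := critical 'i%C; rewrite Dz0 (_ : 'i%C^* = - 'i%C); last first.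
  by apply/eqP; rewrite eq_complex /= oppr0 !eqxx.
rewrite mulrN mulNr -opprD => /eqP; rewrite oppr_eq0 -mulr2n mulrn_eq0 mulf_eq0 /=.
have i0 : 'i%C != 0 :> C by rewrite eq_complex /= oner_eq0 andbF.
by rewrite (negPf i0) orbF.
Qed.

End Sign.

Lemma size_split (T : eqType) (a b c : pred T) (s : seq T) m n :
  (forall x, a x -> b x || c x) -> uniq s -> all a s ->
  (forall t, uniq t -> all b t -> all a t -> (size t <= m)%N) ->
  (forall t, uniq t -> all c t -> all a t -> (size t <= n)%N) ->
  (size s <= m + n)%N.
Proof.
move=> abc us /allP sa tb tc; rewrite -(count_predC b s) -!size_filter.
apply: leq_add; [apply: tb|apply: tc]; rewrite ?filter_uniq ?filter_all //.
- by apply/allP => x; rewrite mem_filter => /andP[_ /sa].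
- apply/allP => x; rewrite mem_filter /= => /andP[bx /sa/abc].
  by rewrite (negPf bx).
by apply/allP => x; rewrite mem_filter => /andP[_ /sa].
Qed.

(** Here p and p' are the sizes of a polynomial and its derivative, e that of a common factor, a and
    b those of the cofactors. *)
Lemma pred_add_gt1 p p' e a b : (p' < p -> p = (e + a).-1 -> p' = (e + b).-1 ->
  1 < e -> 0 < b -> 1 < a)%N.
Proof. by lia. Qed.

Lemma leq_sqr_addM e d n : (e ^ 2 + d * n <= (e + d) * (e + n))%N.
Proof. by rewrite -mulnn; nia. Qed.

(** If the conjugate of x is c x, multiplying x by this square root of c makes it real. *)
Lemma unimodular_sqrt (F : numClosedFieldType) (c : F) : c * c^* = 1 ->
  sqrtC c != 0 /\ (sqrtC c)^* * c = sqrtC c.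
Proof.
move=> cc; split.
  by rewrite sqrtC_eq0; apply/eqP => c0; move/eqP: cc; rewrite c0 mul0r eq_sym oner_eq0.
rewrite -{2}[c]sqrtCK expr2 mulrA -[X in X * _ = _]mulrC -normCK.
have -> : `|sqrtC c| ^+ 2 = 1; last by rewrite mul1r.
by apply/eqP; rewrite -normrX sqrtCK -sqrp_eq1 ?normr_ge0 // normCK cc.
Qed.

(** * Counting the zeros of one polynomial and the common zeros of two *)

Section Count.
Variable R : rcfType.
Local Notation C := R[i].
Implicit Types (D N P : {poly {poly C}}) (z : C) (s : seq C) (k : {poly C}).

Lemma outside_root k : k != 0 -> exists z, ~~ root k z.
Proof.
move=> k0; have /existsNP[z /negP] : ~ forall z, root k z; last by exists z.
move=> rk; move/eqP: k0; apply.
by apply: poly_nat_roots0 => n; apply/rootP.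
Qed.

(** Conjugating twice at a point where [D] does not vanish gives |c| = 1; then a square root of [c]
    is the required multiplier. *)
Lemma real_multiple D k (c : C) : k != 0 ->
  (forall z, planezero D z -> root k z) -> starp D = c%:P%:P * D ->
  exists2 l : C, l != 0 & plane_real (l%:P%:P * D).
Proof.
move=> k0 zk Dc.
have conjD z : (D.[z^*, z])^* = c * D.[z^*, z].
  by rewrite -horner_starp Dc !hornerE.
have [z /(contra (zk z))z0] := outside_root k0.
have cc : c * c^* = 1.
  apply: (mulIf z0); rewrite mul1r -mulrA [c^* * _]mulrC mulrA -conjD -rmorphM /=.
  by rewrite mulrC -conjD conjCK.
have [l0 l1] := unimodular_sqrt cc.
exists (sqrtC c) => // w; rewrite !hornerM !hornerC rmorphM /=.
by rewrite [X in _ * X = _]conjD mulrA l1.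
Qed.

Lemma sizeY_deriv D : (sizeY D^`() <= sizeY D)%N.
Proof.
apply/bigmax_leqP => i _; rewrite coef_deriv.
apply: leq_trans (max_size_coefXY D i.+1); rewrite -scaler_nat.
exact: size_scale_leq.
Qed.

Lemma bideg_gt0 D : (1 < size D)%N -> (0 < bideg D)%N.
Proof. by move=> sD; rewrite addn_gt0 -subn1 subn_gt0 sD. Qed.

(** Induction on [bideg D]: [D] is paired with its reflection or, if it is real up to a constant,
    with its derivative. A pair without common factor falls under the resultant bound; a proper
    factor splits [D]. *)
Lemma planezero_card D k s : D != 0 -> k != 0 ->
  (forall z, planezero D z -> root k z) ->
  uniq s -> all (planezero D) s -> (size s <= bideg D ^ 2)%N.
Proof.
elim: (bideg D).+1 {-2}D (ltnSn (bideg D)) s => // n IH {}D lt_n s D0 k0 zk us sz.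
have le1 N : N != 0 -> (size N <= 1)%N -> bideg N = bideg D ->
    all (planezero N) s -> (size s <= bideg D ^ 2)%N.
  move=> N0 sN <- zN; apply: leq_trans (planezero_size_le1 N0 sN us zN) _.
  by rewrite expnS expn1; case: (bideg N) => // m; rewrite leq_pmull.
(* Splitting is harmless because a^2 + b^2 <= (a + b)^2. *)
have split N P : bideg (N * P) = bideg D -> planezero (N * P) =1 planezero D ->
    N * P != 0 -> (0 < bideg N)%N -> (0 < bideg P)%N -> (size s <= bideg D ^ 2)%N.
  move=> ED zE; rewrite mulf_eq0 negb_or => /andP[N0 P0] bN bP.
  rewrite bidegM // in ED.
  have [ltN ltP] : (bideg N < n)%N /\ (bideg P < n)%N.
    by move: ED lt_n bN bP; move: (bideg N) (bideg P) (bideg D); lia.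
  have zNP z : planezero D z = planezero N z || planezero P z by rewrite -zE planezeroM.
  apply: (@leq_trans (bideg N ^ 2 + bideg P ^ 2)); last by rewrite -ED sqrnD leq_addr.
  apply: (@size_split _ (planezero D) (planezero N) (planezero P)) => //.
  - by move=> z; rewrite zNP.
  - move=> t ut tN _; apply: IH => //.
    by move=> z zN; apply: zk; rewrite zNP zN.
  move=> t ut tP _; apply: IH => //.
  by move=> z zP; apply: zk; rewrite zNP zP orbT.
have starD0 : starp D != 0 by rewrite starp_eq0.
have sz' : all (planezero (starp D)) s by rewrite (eq_all (planezero_starp D)).
have [sD|sD] := leqP (size D) 1; first exact: le1 sz.
have [sY|sY] := leqP (sizeY D) 1.
  by apply: le1 sz'; rewrite ?size_starp ?bideg_starp.
have [few|[E [D1 [D2 [sE ED1 ED2]]]]] := few_common_or_factor D0 starD0 sD.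
  by rewrite expnS expn1 -{2}bideg_starp; apply: few.
(* The common factor [E] is not constant, so a nonconstant [D1] splits [D]. Otherwise [D] divides
   its reflection up to a constant, and equality of [bideg] makes the two proportional. *)
have [bD1|] := ltnP 0 (bideg D1).
  by apply: (split E D1); rewrite -?ED1 // bideg_gt0.
rewrite leqn0 => /eqP bD1.
have [E0 D10] : E != 0 /\ D1 != 0.
  by apply/andP; rewrite -negb_or -mulf_eq0 -ED1.
have D20 : D2 != 0 by move: starD0; rewrite ED2 mulf_eq0 negb_or => /andP[].
have bD2 : bideg D2 = 0%N.
  by have /eqP := bideg_starp D; rewrite ED2 ED1 !bidegM // bD1 eqn_add2l => /eqP.
have {bD1}D1c := bideg0 bD1; have {bD2}D2c := bideg0 bD2.
move: D1c D2c; set d1 := _`_0; set d2 := _`_0 => D1c D2c; clearbody d1 d2.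
have d10 : d1 != 0 by apply: contraNneq D10 => d10; rewrite D1c d10 !polyC0.
have Dc : starp D = (d1^-1 * d2)%:P%:P * D.
  rewrite ED2 ED1 D1c D2c mulrCA; congr (_ * _).
  by rewrite -!polyCM mulrAC mulVf // mul1r.
have [l l0 rD] := real_multiple k0 zk Dc.
set P := l%:P%:P * D in rD.
have lP0 : l%:P%:P != 0 :> {poly {poly C}} by rewrite !polyC_eq0.
have P0 : P != 0 by rewrite mulf_neq0.
have zP : planezero P =1 planezero D.
  by move=> z; rewrite planezeroM /planezero !hornerC (negPf l0).
have bP : bideg P = bideg D.
  by rewrite bidegM // /bideg sizeYE swapXY_polyC map_polyC !size_polyC polyC_eq0 l0.
have zkP z : planezero P z -> root k z by rewrite zP; apply: zk.
have sP : size P = size D by rewrite /P mul_polyC size_scale // polyC_eq0.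
have sP1 : (1 < size P)%N by rewrite sP.
have sP' : (size P^`() < size P)%N by rewrite lt_size_deriv.
have P'0 : P^`() != 0.
  apply/eqP => /(congr1 (fun Q : {poly {poly C}} => Q`_(size P).-2)) /eqP.
  rewrite coef_deriv coef0 -scaler_nat scaler_eq0 pnatr_eq0 /= prednK -?subn1 ?subn_gt0 //.
  by rewrite subn1 -lead_coefE lead_coef_eq0 (negPf P0).
have szP : all (planezero P) s by rewrite (eq_all zP).
have szP' : all (planezero P^`()) s.
  by apply/allP => z /(allP szP); apply: planezero_deriv rD k0 zkP.
have [few|[E' [P1 [P2 [sE' EP1 EP2]]]]] := few_common_or_factor P0 P'0 sP1.
  apply: leq_trans (few s us szP szP') _; rewrite expnS expn1 bP leq_mul2l -bP.
  by apply/orP; right; rewrite leq_add // -!subn1 leq_sub2r ?sizeY_deriv // ltnW.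
have [E'0 P20] : E' != 0 /\ P2 != 0 by apply/andP; rewrite -negb_or -mulf_eq0 -EP2.
have P10 : P1 != 0 by move: P0; rewrite EP1 mulf_eq0 negb_or => /andP[].
(* The derivative has smaller outer degree than [P], so the common factor [E'] is a proper one. *)
apply: (split E' P1); rewrite -?EP1 // bideg_gt0 //.
apply: (pred_add_gt1 sP' _ _ sE' (b := size P2)); last by rewrite size_poly_gt0.
  by rewrite {1}EP1 size_mul.
by rewrite {1}EP2 size_mul.
Qed.

(** A common factor [E] vanishes only at common zeros, so [planezero_card] applies to it; the
    cofactors go to the induction, and e^2 + dn <= (e + d)(e + n). *)
Lemma common_planezero_card D N k s : D != 0 -> N != 0 -> k != 0 ->
  (forall z, planezero D z -> planezero N z -> root k z) ->
  uniq s -> all (planezero D) s -> all (planezero N) s ->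
  (size s <= bideg D * bideg N)%N.
Proof.
elim: (bideg D).+1 {-2}D (ltnSn (bideg D)) N s => // n IH {}D lt_n N s D0 N0 k0 zk us sD sN.
have [sizeD|sizeD] := leqP (size D) 1.
  have [bN|bN] := posnP (bideg N).
    have EN := bideg0 bN.
    case: s us sN {sD} => // z s _ /andP[+ _].
    rewrite /planezero EN !hornerC => n0.
    by case/negP: N0; rewrite EN !polyC_eq0.
  apply: leq_trans (planezero_size_le1 D0 sizeD us sD) _.
  by rewrite leq_pmulr.
have [few|[E [D' [N' [sE ED EN]]]]] := few_common_or_factor D0 N0 sizeD.
  exact: few.
have [E0 D'0] : E != 0 /\ D' != 0 by apply/andP; rewrite -negb_or -mulf_eq0 -ED.
have N'0 : N' != 0 by move: N0; rewrite EN mulf_eq0 negb_or => /andP[].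
have bE := bideg_gt0 sE.
have bD : bideg D = (bideg E + bideg D')%N by rewrite ED bidegM.
have bN : bideg N = (bideg E + bideg N')%N by rewrite EN bidegM.
apply: (@leq_trans (bideg E ^ 2 + bideg D' * bideg N')); last by rewrite bD bN leq_sqr_addM.
apply: (@size_split _ (predI (planezero D) (planezero N)) (planezero E)
   (predI (planezero D') (planezero N'))) => //.
- by move=> z /andP[]; rewrite /= ED EN !planezeroM; case: (planezero E z) => //= -> ->.
- by rewrite all_predI sD.
- move=> t ut tE _; apply: (planezero_card E0 k0) => // z zE.
  by apply: zk; rewrite ?ED ?EN planezeroM zE.
move=> t ut; rewrite all_predI => /andP[tD tN] _; apply: IH => //.
  rewrite bD ltnS in lt_n; apply: leq_trans lt_n.
  by rewrite -[X in (X < _)%N]add0n ltn_add2r.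
by move=> z zD zN; apply: zk; rewrite ?ED ?EN planezeroM ?zD ?zN orbT.
Qed.

End Count.

(** * Lueroth's theorem *)

Lemma clear_denominators_step (L : comNzRingType) (N : {poly L}) (c d f n : L) :
  d * f = n ->
  d%:P * (c%:P * N) * 'X + c%:P * n%:P = (c * d)%:P * (N * 'X + f%:P).
Proof. by move=> <-; rewrite !polyCM; ring. Qed.

Lemma sizeY_cross (F : idomainType) (p q : {poly F}) m :
  (size p <= m)%N -> (size q <= m)%N ->
  (sizeY (p^:P * q%:P - p%:P * q^:P) <= m)%N.
Proof.
have sw a b : swapXY (a^:P * b%:P) = a *: b^:P :> {poly {poly F}}.
  by rewrite rmorphM /= swapXY_map_polyC swapXY_polyC mul_polyC.
have sz (a b : {poly F}) : (size (a *: b^:P)%R <= size b)%N.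
  by rewrite (leq_trans (size_scale_leq _ _)) // size_map_polyC.
have sw' a b : swapXY (a%:P * b^:P) = b *: a^:P :> {poly {poly F}} by rewrite mulrC sw.
move=> pm qm; rewrite sizeYE.
have -> : swapXY (p^:P * q%:P - p%:P * q^:P) = p *: q^:P - q *: p^:P.
  by apply: etrans (raddfB swapXY _ _) _; congr (_ - _); [exact: sw|exact: sw'].
rewrite (leq_trans (size_polyD _ _)) // size_polyN geq_max.
by rewrite (leq_trans (sz p q)) // (leq_trans (sz q p)).
Qed.

(** * Intermediate fields of the rational function field, given abstractly by [tau], [num] and
    [den] *)

Section Luroth.
Variable F : closedFieldType.
Variables (K : fieldType) (tau : {rmorphism {poly F} -> K}).
Variables (num den : K -> {poly F}).
Hypothesis tau_inj : injective tau.
Hypothesis den0 : forall f, den f != 0.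
Hypothesis coprime_num_den : forall f, coprimep (num f) (den f).
Hypothesis numdenE : forall f, f = tau (num f) / tau (den f).
Implicit Types (f g : K) (S T : K -> Prop) (p q : {poly F}) (P Q M N : {poly K}).

Definition ratC : {rmorphism F -> K} := [the {rmorphism F -> K} of (tau \o polyC)].
Local Notation liftP := (map_poly ratC).
Local Notation z := (tau 'X).

Lemma tau_eq0 p : (tau p == 0) = (p == 0).
Proof. by rewrite -(inj_eq tau_inj) rmorph0. Qed.

Lemma numdenM f : tau (den f) * f = tau (num f).
Proof. by rewrite {2}[f]numdenE mulrC divfK // tau_eq0 den0. Qed.

Definition ratconst f := exists c, f = ratC c.

Record subfield S : Prop := Subfield {
  subfield_const c : S (ratC c);
  subfieldB f g : S f -> S g -> S (f - g);
  subfieldM f g : S f -> S g -> S (f * g);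
  subfieldV f : S f -> S f^-1 }.

Definition polyS S P := forall i, S P`_i.

Lemma subfieldI S T : subfield S -> subfield T -> subfield (fun f => S f /\ T f).
Proof.
move=> [Sc SB SM SV] [Tc TB TM TV]; split=> [c|f g []|f g []|f []]; auto.
- by move=> ? ? []; auto.
- by move=> ? ? []; auto.
Qed.

Section Closure.
Variables (S : K -> Prop) (sS : subfield S).

Lemma subfield0 : S 0. Proof. by have := subfield_const sS 0; rewrite rmorph0. Qed.
Lemma subfield1 : S 1. Proof. by have := subfield_const sS 1; rewrite rmorph1. Qed.
Lemma subfieldN f : S f -> S (- f).
Proof. by move=> Sf; rewrite -sub0r; apply: (subfieldB sS) => //; exact: subfield0. Qed.
Lemma subfieldD f g : S f -> S g -> S (f + g).
Proof. by move=> Sf Sg; rewrite -[g]opprK; apply: (subfieldB sS) => //; exact: subfieldN. Qed.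
Lemma subfield_div f g : S f -> S g -> S (f / g).
Proof. by move=> Sf Sg; apply: (subfieldM sS) => //; exact: subfieldV. Qed.

Lemma subfield_sum I (r : seq I) (pr : pred I) (E : I -> K) :
  (forall i, S (E i)) -> S (\sum_(i <- r | pr i) E i).
Proof. by move=> SE; apply: big_ind => //; [exact: subfield0|exact: subfieldD]. Qed.

Lemma polySB P Q : polyS S P -> polyS S Q -> polyS S (P - Q).
Proof. by move=> SP SQ i; rewrite coefB; apply: (subfieldB sS). Qed.
Lemma polySD P Q : polyS S P -> polyS S Q -> polyS S (P + Q).
Proof. by move=> SP SQ i; rewrite coefD; apply: subfieldD. Qed.
Lemma polySM P Q : polyS S P -> polyS S Q -> polyS S (P * Q).
Proof. by move=> SP SQ i; rewrite coefM; apply: subfield_sum => j; apply: (subfieldM sS). Qed.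
Lemma polySZ f P : S f -> polyS S P -> polyS S (f *: P).
Proof. by move=> Sf SP i; rewrite coefZ; apply: (subfieldM sS). Qed.
Lemma polyS_lift p : polyS S (liftP p).
Proof. by move=> i; rewrite coef_map; apply: (subfield_const sS). Qed.
Lemma polyS0 : polyS S 0.
Proof. by move=> i; rewrite coef0; apply: subfield0. Qed.

(** Euclidean division is redone here to keep the coefficients of quotient and remainder in [S]. *)
Lemma polyS_div P Q : Q != 0 -> polyS S P -> polyS S Q ->
  exists A B, [/\ polyS S A, polyS S B, P = A * Q + B & (size B < size Q)%N].
Proof.
move=> Q0; elim: (size P).+1 {-2}P (ltnSn (size P)) => // n IH {}P ltn SP SQ.
have [PQ|QP] := ltnP (size P) (size Q).
  by exists 0, P; split; rewrite ?mul0r ?add0r //; exact: polyS0.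
pose c := (lead_coef P / lead_coef Q) *: 'X^(size P - size Q).
have Sc : polyS S c.
  apply: polySZ => [|i]; first by apply: subfield_div; rewrite lead_coefE.
  by rewrite coefXn; case: eqP => _; [exact: subfield1|exact: subfield0].
have sQ : (0 < size Q)%N by rewrite size_poly_gt0.
have sP : (0 < size P)%N by apply: leq_trans QP.
have ltP : (size (P - c * Q)%R < size P)%N.
  rewrite -(prednK sP) ltnS; apply/leq_sizeP => j; rewrite leq_eqVlt => /orP[/eqP <-|lt_j].
    rewrite coefB -scalerAl coefZ coefXnM -lead_coefE ifN; last by rewrite -leqNgt -subn1 leq_sub2l.
    have -> : ((size P).-1 - (size P - size Q) = (size Q).-1)%N.
      by rewrite -!subn1 subnAC subKn.
    by rewrite -lead_coefE divfK ?subrr // lead_coef_eq0.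
  apply/leq_sizeP : j lt_j; rewrite prednK //.
  rewrite (leq_trans (size_polyD _ _)) // geq_max leqnn size_polyN /=.
  rewrite -scalerAl (leq_trans (size_scale_leq _ _)) // mulrC size_mulXn //.
  by rewrite subnK.
have [||A [B [SA SB E sB]]] := IH (P - c * Q) _ _ SQ.
- exact: leq_trans ltP ltn.
- by apply: polySB => //; apply: polySM.
exists (A + c), B; split => //; first exact: polySD.
by rewrite mulrDl addrAC -E subrK.
Qed.

End Closure.

Lemma horner_lift p : (liftP p).[z] = (tau p).
Proof.
elim/poly_ind: p => [|p c IH]; first by rewrite rmorph0 horner0 (rmorph0 tau).
by rewrite rmorphD rmorphM /= map_polyX map_polyC hornerMXaddC IH -(rmorphM tau) -(rmorphD tau).
Qed.

(** A polynomial over the field generated by [f] with root z; for nonconstant [f] its degree is the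
    degree of [f]. *)
Definition fiberpoly f := liftP (num f) - f *: liftP (den f).

Lemma fiberpoly_root f : (fiberpoly f).[z] = 0.
Proof.
rewrite hornerD hornerN hornerZ !horner_lift {2}[f]numdenE mulfVK ?subrr //.
by rewrite tau_eq0 den0.
Qed.

Lemma fiberpoly_neq0 f : ~ ratconst f -> fiberpoly f != 0.
Proof.
move=> fc; apply/eqP => /polyP E; have := den0 f.
rewrite -lead_coef_eq0 lead_coefE => d0; apply: fc.
have := E (size (den f)).-1; rewrite coefB coefZ !coef_map coef0.
move/eqP; rewrite subr_eq0 => /eqP Ef.
exists ((num f)`_(size (den f)).-1 / (den f)`_(size (den f)).-1).
by rewrite rmorphM fmorphV Ef mulfK // fmorph_eq0.
Qed.

Lemma polyS_fiberpoly S f : subfield S -> S f -> polyS S (fiberpoly f).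
Proof.
by move=> sS Sf; apply: (polySB sS); [|apply: (polySZ sS) => //]; apply: polyS_lift.
Qed.

Lemma clear_denominators N : exists2 k : {poly F}, k != 0 &
  exists N' : {poly {poly F}}, map_poly tau N' = (tau k) *: N.
Proof.
elim/poly_ind: N => [|N f [k k0 [N' EN']]].
  by exists 1; rewrite ?oner_neq0 //; exists 0; rewrite rmorph0 scaler0.
exists (k * den f); first by rewrite mulf_neq0 ?den0.
exists ((den f)%:P * N' * 'X + (k * num f)%:P).
have Ef := numdenM f.
rewrite rmorphD !rmorphM /= map_polyX !map_polyC /= EN' -!mul_polyC.
exact: clear_denominators_step.
Qed.

(** Clearing denominators and dividing by the content leaves a multiple of [M]; as [M] is monic, the
    multiplier is the leading coefficient. *)
Lemma primitive_multiple M : M \is monic -> exists M1 : {poly {poly F}},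
  primitive M1 /\ map_poly tau M1 = (tau (lead_coef M1)) *: M.
Proof.
move=> monM; have [k k0 [N EN]] := clear_denominators M.
have M0 := monic_neq0 monM.
have kF0 : (tau k) != 0 by rewrite tau_eq0.
have N0 : N != 0.
  apply: contra_eq_neq EN => ->; rewrite rmorph0 eq_sym.
  by rewrite scaler_eq0 negb_or kF0.
have [c [M1 [c0 pM1 EN1]]] := primitive_part N0.
have cF0 : (tau c) != 0 by rewrite tau_eq0.
exists M1; split => //.
have leadN : lead_coef N = k.
  apply: tau_inj; rewrite -(lead_coef_map_inj tau_inj) ?rmorph0 //.
  by rewrite EN lead_coefZ (monicP monM) mulr1.
have Ek : k = c * lead_coef M1 by rewrite -leadN EN1 lead_coefM lead_coefC.
have /(scalerI cF0) : (tau c) *: map_poly tau M1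
    = (tau c) *: ((tau (lead_coef M1)) *: M); last by [].
by rewrite scalerA -(rmorphM tau) -Ek -EN EN1 rmorphM /= map_polyC mul_polyC.
Qed.

Lemma fiberpoly_clear f : let Ff := (num f)^:P * (den f)%:P - (num f)%:P * (den f)^:P in
  map_poly tau Ff = (tau (den f)) *: fiberpoly f.
Proof.
have lift p : map_poly tau p^:P = liftP p.
  by rewrite -map_poly_comp.
rewrite /= rmorphB !rmorphM /= !lift !map_polyC /= /fiberpoly scalerBr scalerA.
congr (_ - _); first by rewrite mulrC mul_polyC.
by rewrite mul_polyC numdenM.
Qed.

(* The degree argument behind Lueroth's theorem: the coefficient [f] of [M]
   has degree at most the degree of [M1] in the inner variable, which is
   therefore the whole degree of the polynomial [Ff] that [M1] divides; the
   cofactor depends on the outer variable only, and [Ff] has no such factor. *)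
Lemma size_minimal_fiberpoly M f j : M \is monic -> f = M`_j -> ~ ratconst f ->
  M %| fiberpoly f -> (size (fiberpoly f) <= size M)%N.
Proof.
move=> monM Ef fc /dvdpP[Q EQ].
have [M1 [pM1 EM1]] := primitive_multiple monM.
set p := num f; set q := den f.
pose Ff := p^:P * q%:P - p%:P * q^:P.
have EFf : map_poly tau Ff = (tau q) *: fiberpoly f by apply: fiberpoly_clear.
have mapI : injective (map_poly tau).
  by apply: map_inj_poly => //; rewrite (rmorph0 tau).
have size_map (N : {poly {poly F}}) : size (map_poly tau N) = size N.
  by rewrite size_map_inj_poly ?(rmorph0 tau).
have q0 : q != 0 by apply: den0.
have qF0 : (tau q) != 0 by rewrite tau_eq0.
have M10 : M1 != 0.
  by apply: contraNneq (pM1 0) => ->; rewrite rmorph0.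
have l0 : lead_coef M1 != 0 by rewrite lead_coef_eq0.
have lF0 : (tau (lead_coef M1)) != 0 by rewrite tau_eq0.
have Ff0 : Ff != 0.
  apply: contraNneq (fiberpoly_neq0 fc) => Ff0.
  move/eqP: EFf; rewrite Ff0 rmorph0 eq_sym scaler_eq0 (negPf qF0) /=.
  by move=> ->.
have [k k0 [N EN]] := clear_denominators ((tau q) *: Q).
have /(gauss_primitive pM1)[] : (k * lead_coef M1)%:P * Ff = M1 * N.
- apply: mapI; rewrite !rmorphM /= !map_polyC /= EFf EM1 EN EQ.
  by rewrite -!mul_polyC ?rmorphM; ring.
- by rewrite mulf_neq0.
move=> N' {N EN k k0 Q EQ}EN'.
have N'0 : N' != 0 by apply: contraNneq Ff0 => N'0; rewrite EN' N'0 mulr0.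
have pq : coprimep q p by rewrite coprimep_sym coprime_num_den.
(* Since [f] = p/q is the ratio of two coefficients of [M1], coprimality makes q divide one of them
   and p the other. *)
have coefM1 : p * lead_coef M1 = q * M1`_j.
  have E1 : tau M1`_j = tau (lead_coef M1) * f by rewrite -coef_map EM1 coefZ -Ef.
  by apply: tau_inj; rewrite !rmorphM /= E1 mulrCA numdenM mulrC.
have p0 : p != 0.
  apply: contra_not_neq fc => p0; exists 0.
  by rewrite [f]numdenE -/p p0 (rmorph0 tau) mul0r rmorph0.
have /Pdiv.Field.dvdpP[t Et] : q %| lead_coef M1.
  by rewrite -(Gauss_dvdpr _ pq) coefM1 dvdp_mulr.
have t0 : t != 0 by apply: contraNneq l0 => t0; rewrite Et t0 mul0r.
have Et' : M1`_j = t * p by apply: (mulfI q0); rewrite -coefM1 Et; ring.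
have le_size (r s : {poly F}) : r != 0 -> s != 0 -> (size s <= size (r * s)%R)%N.
  by move=> r0 s0; rewrite dvdp_leq ?mulf_neq0 // dvdp_mulIr.
have size_q : (size q <= sizeY M1)%N.
  by apply: leq_trans (max_size_lead_coefXY M1); rewrite Et le_size.
have size_p : (size p <= sizeY M1)%N.
  by apply: leq_trans (max_size_coefXY M1 j); rewrite Et' le_size.
have size_Ff : (sizeY Ff <= sizeY M1)%N.
  exact: sizeY_cross.
have sN' : (size (swapXY N') <= 1)%N.
  have : (sizeY (M1 * N') <= sizeY M1)%N by rewrite -EN'.
  rewrite !sizeYE rmorphM size_mul ?swapXY_eq0 //= -subn1 leq_subLR addnC.
  by rewrite leq_add2r.
have [n EN'n] : exists n : {poly F}, N' = n^:P.
  exists (swapXY N')`_0; rewrite -swapXY_polyC -(size1_polyC sN').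
  by rewrite swapXYK.
have n0 : n != 0 by apply: contraNneq N'0 => n0; rewrite EN'n n0 rmorph0.
(* At a root c of [n], [Ff] would vanish, so p(c)q = q(c)p and [f] would be constant. *)
have sn : (size n <= 1)%N.
  rewrite leqNgt; apply/negP => /nonconst_root[c /rootP nc].
  have : Ff.[c%:P] = 0.
    by rewrite EN' EN'n hornerM horner_map /= nc mulr0.
  rewrite hornerD hornerN !hornerM !hornerC !horner_map /= => /eqP.
  rewrite subr_eq0 mul_polyC mulrC mul_polyC => /eqP Epq.
  have qc : q.[c] != 0.
    apply: contraTneq pq => qc; move/eqP: Epq; rewrite qc scale0r scaler_eq0.
    rewrite (negPf q0) orbF => pc; apply/negP => /coprimep_root/(_ (introT eqP qc)).
    by rewrite (eqP pc) eqxx.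
  apply: fc; exists (p.[c] / q.[c]); rewrite [f]numdenE -/p -/q.
  have -> : p = (p.[c] / q.[c]) *: q by rewrite mulrC -scalerA Epq scalerA mulVf ?scale1r.
  rewrite -mul_polyC rmorphM mulfK //= mul_polyC hornerZ mulfK //.
have sN'1 : size N' = 1%N.
  by apply/eqP; rewrite EN'n size_map_polyC eqn_leq sn size_poly_gt0.
have -> : size (fiberpoly f) = size Ff by rewrite -(size_map Ff) EFf size_scale.
rewrite EN' size_mul // sN'1 addn1 /= -(size_map M1) EM1 size_scale //.
Qed.

(** The generator is a nonconstant coefficient of the monic polynomial of least degree over [S] with
    root z; its [fiberpoly] attains that degree. Dividing [num g] and [den g] by it leaves
    remainders r, s over both [S] and [T]. By minimality r = gs, so g is a ratio of coefficients in
    [T]. *)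
Lemma luroth S : subfield S -> (exists2 f, S f & ~ ratconst f) ->
  exists f, [/\ S f, ~ ratconst f &
    forall T, subfield T -> T f -> forall g, S g -> T g].
Proof.
move=> sS [f0 Sf0 f0c].
pose vanishing n := `[< exists P, [/\ P != 0, polyS S P, P.[z] = 0 & size P = n] >].
have : exists n, vanishing n.
  exists (size (fiberpoly f0)); apply/asboolP; exists (fiberpoly f0); split=> //.
  - exact: fiberpoly_neq0.
  - exact: polyS_fiberpoly.
  - exact: fiberpoly_root.
move=> /ex_minnP[n /asboolP[P [P0 SP Pz sP]] minP].
have {}minP N : polyS S N -> N.[z] = 0 -> (size N < n)%N -> N = 0.
  move=> SN Nz; rewrite ltnNge => /negP sN; apply/eqP; apply: contra_notT sN => N0.
  by apply: minP; apply/asboolP; exists N.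
pose M := (lead_coef P)^-1 *: P.
have l0 : lead_coef P != 0 by rewrite lead_coef_eq0.
have monM : M \is monic by rewrite monicE lead_coefZ mulVf.
have SM : polyS S M.
  by apply: (polySZ sS) => //; apply: (subfieldV sS); rewrite lead_coefE.
have Mz : M.[z] = 0 by rewrite hornerZ Pz mulr0.
have sM : size M = n by rewrite size_scale ?invr_eq0.
(* With constant coefficients only, [M] would make z algebraic over the constants. *)
have [j Mj] : exists j, ~ ratconst M`_j.
  apply/existsNP => Mconst; have [m mE] := choice Mconst.
  pose m' := \poly_(i < size M) m i.
  have EM : M = liftP m'.
    apply/polyP => i; rewrite coef_map coef_poly; case: ltnP => [_|le]; first exact: mE.
    by rewrite nth_default //; exact: esym (rmorph0 ratC).
  move: Mz; rewrite EM horner_lift => /eqP; rewrite tau_eq0 => /eqP m'0.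
  by move: (monic_neq0 monM); rewrite EM m'0 rmorph0 eqxx.
have M0 := monic_neq0 monM.
have sS_div N : polyS S N -> N.[z] = 0 -> M %| N.
  move=> SN Nz; have [A [B [SA SB EN sB]]] := polyS_div sS M0 SN SM.
  rewrite EN (minP B) ?addr0 ?dvdp_mull -?sM //.
  by move: Nz; rewrite EN hornerD hornerM Mz mulr0 add0r.
exists M`_j; split => // T sT Tf g Sg.
have sM_f : (size (fiberpoly M`_j) <= n)%N.
  rewrite -sM; apply: size_minimal_fiberpoly Mj _ => //.
  by apply: sS_div; [apply: polyS_fiberpoly|apply: fiberpoly_root].
have sI := subfieldI sS sT.
have SIf : polyS (fun f => S f /\ T f) (fiberpoly M`_j) by apply: polyS_fiberpoly.
have f0' := fiberpoly_neq0 Mj.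
have [A [r [_ Sr Er sr]]] := polyS_div sI f0' (polyS_lift sI (num g)) SIf.
have [B [s [_ Ss Es ss]]] := polyS_div sI f0' (polyS_lift sI (den g)) SIf.
have rz : r.[z] = tau (num g).
  by rewrite -(horner_lift (num g)) Er hornerD hornerM fiberpoly_root mulr0 add0r.
have sz : s.[z] = tau (den g).
  by rewrite -(horner_lift (den g)) Es hornerD hornerM fiberpoly_root mulr0 add0r.
have /eqP : r - g *: s = 0.
  apply: minP.
  - apply: (polySB sS) => [i|]; first by case: (Sr i).
    by apply: (polySZ sS) => // i; case: (Ss i).
  - by rewrite hornerD hornerN hornerZ rz sz mulrC numdenM subrr.
  apply: leq_trans sM_f; apply: leq_ltn_trans (size_polyD _ _) _.
  by rewrite size_polyN gtn_max sr (leq_ltn_trans (size_scale_leq _ _)).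
rewrite subr_eq0 => /eqP Ers.
have s0 : s != 0.
  apply: contraNneq (den0 g) => s0; rewrite -tau_eq0 -sz s0 horner0 //.
have -> : g = r`_(size s).-1 / s`_(size s).-1.
  by rewrite Ers coefZ mulfK // -lead_coefE lead_coef_eq0.
by apply: (subfield_div sT); [case: (Sr (size s).-1)|case: (Ss (size s).-1)].
Qed.

End Luroth.

(** * Conjugation along a dense set *)

Lemma deriv_eq0_size (F : numDomainType) (p : {poly F}) : p^`() = 0 -> (size p <= 1)%N.
Proof.
move=> p'0; rewrite leqNgt; apply/negP => sp.
have /eqP := congr1 (fun q : {poly F} => q`_(size p).-2) p'0.
rewrite coef_deriv coef0 mulrn_eq0 /= prednK -?subn1 ?subn_gt0 //.
rewrite subn1 -lead_coefE lead_coef_eq0 => /eqP p0.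
by move: sp; rewrite p0 size_poly0.
Qed.

Lemma coprimep_no_common (F : fieldType) (p q : {poly F}) x :
  coprimep p q -> p.[x] = 0 -> q.[x] != 0.
Proof. by move=> pq /rootP/(coprimep_root pq). Qed.

(* If x = G(h)/H(h) with h = A/B, then A - cB has at most one distinct root for
   every c; a multiple root is a zero of A'B - AB', so only finitely many c
   allow one and A, B have degree at most 1. *)
Lemma size_moebius (F : numClosedFieldType) (A B G H : {poly F}) :
  coprimep A B -> coprimep G H ->
  (forall x, B.[x] != 0 -> x * H.[A.[x] / B.[x]] = G.[A.[x] / B.[x]]) ->
  (size A <= 2)%N /\ (size B <= 2)%N.
Proof.
move=> AB GH inv.
have uniq_root c x y : root (A - c *: B) x -> root (A - c *: B) y -> x = y.
  have at_root t : root (A - c *: B) t -> t * H.[c] = G.[c].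
    rewrite /root !hornerE subr_eq0 => /eqP Et.
    have Bt : B.[t] != 0.
      apply/eqP => Bt; have At : A.[t] = 0 by rewrite Et Bt mulr0.
      by have := coprimep_no_common AB At; rewrite Bt eqxx.
    by have := inv t Bt; rewrite Et mulfK.
  move=> /at_root Ex /at_root Ey.
  have Hc : H.[c] != 0.
    apply/eqP => Hc; have Gc : G.[c] = 0 by rewrite -Ex Hc mulr0.
    by have := coprimep_no_common GH Gc; rewrite Hc eqxx.
  by apply: (mulIf Hc); rewrite Ex Ey.
pose w := A^`() * B - A * B^`().
(* If the Wronskian vanishes, each of [A] and [B] divides its own derivative and is constant. *)
have [w0|w0] := eqVneq w 0.
  have dvd_deriv (P Q : {poly F}) : coprimep P Q -> P^`() * Q = P * Q^`() -> (size P <= 1)%N.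
    move=> PQ E; apply: deriv_eq0_size; apply/eqP; apply: contraT => P'0.
    have : P %| P^`() by rewrite -(Gauss_dvdpl _ PQ) E dvdp_mulIl.
    move=> /(dvdp_leq P'0); rewrite leqNgt lt_size_deriv //.
    by apply: contraNneq P'0 => ->; rewrite deriv0.
  have Ew : A^`() * B = A * B^`() by apply/eqP; rewrite -subr_eq0 -/w w0.
  split; apply: leqW; first exact: dvd_deriv AB Ew.
  by rewrite coprimep_sym in AB; apply: dvd_deriv AB _; rewrite mulrC -Ew mulrC.
(* Degree at least 2 gives two roots, equal by [uniq_root], hence a double root, where [w]
   vanishes. *)
have bad_root c : (2 < size (A - c *: B)%R)%N -> exists r, root w r /\ A.[r] = c * B.[r] /\ B.[r] != 0.
  set P := A - c *: B => sP.
  have [rs EP] := closed_field_poly_normal P.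
  have P0 : P != 0 by rewrite -size_poly_gt0; apply: leq_trans sP.
  have srs : (1 < size rs)%N.
    move: sP; rewrite EP size_scale ?lead_coef_eq0 //.
    by rewrite (big_nth 0) big_mkord size_prod_XsubC /index_enum -enumT size_enum_ord.
  case: rs EP srs => [//|r [//|r' rs]] EP _.
  have rr : root P r by rewrite EP rootZ ?lead_coef_eq0 // root_prod_XsubC mem_head.
  have rr' : root P r' by rewrite EP rootZ ?lead_coef_eq0 // root_prod_XsubC !inE eqxx orbT.
  have Err := uniq_root _ _ _ rr rr'; rewrite -{r' rr'}Err in EP.
  have P'r : P^`().[r] = 0.
    by rewrite EP !big_cons derivZ !derivM derivXsubC !hornerE subrr !(mul0r, mulr0, add0r).
  move: rr P'r; rewrite /root /P !derivE !hornerE => /eqP Er E'r.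
  have {}Er : A.[r] = c * B.[r] by apply/eqP; rewrite -subr_eq0 Er.
  have {}E'r : A^`().[r] = c * B^`().[r] by apply/eqP; rewrite -subr_eq0 E'r.
  exists r; split; last split => //.
    by rewrite /w !hornerE Er E'r; apply/eqP; ring.
  apply/eqP => Br; have Ar : A.[r] = 0 by rewrite Er Br mulr0.
  by have := coprimep_no_common AB Ar; rewrite Br eqxx.
(* Distinct bad constants have distinct double roots, because [A / B] takes these constants as
   values there; but [w] has finitely many roots. *)
have good N : exists2 n, (N <= n)%N & (size (A - n%:R *: B)%R <= 2)%N.
  apply: contrapT => none.
  have bad n : exists r, root w r /\ A.[r] = (N + n)%:R * B.[r] /\ B.[r] != 0.
    apply: bad_root; rewrite ltnNge; apply/negP => le2; apply: none.
    by exists (N + n)%N; rewrite ?leq_addr.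
  have [r rP] := choice bad.
  have : (size [seq r n | n <- iota 0 (size w)] < size w)%N.
    apply: max_poly_roots => //.
      by apply/allP => _ /mapP[n _ ->]; case: (rP n).
    rewrite map_inj_uniq ?iota_uniq // => m n Emn.
    have [_ [Em Br]] := rP m; have [_ [En _]] := rP n.
    move: Em; rewrite Emn En => /eqP; rewrite Emn in Br.
    by rewrite (inj_eq (mulIf Br)) eqr_nat eqn_add2l => /eqP.
  by rewrite size_map size_iota ltnn.
(* [A] and [B] are combinations of two polynomials of degree at most 1. *)
have [m _ sm] := good 0; have [n lt_mn sn] := good m.+1.
have nm0 : n%:R - m%:R != 0 :> F by rewrite subr_eq0 eqr_nat gtn_eqF.
have le2D (P Q : {poly F}) a : (size P <= 2)%N -> (size Q <= 2)%N -> (size (P + a *: Q)%R <= 2)%N.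
  move=> sP sQ; rewrite (leq_trans (size_polyD _ _)) // geq_max sP.
  by rewrite (leq_trans (size_scale_leq _ _)).
have sB : (size B <= 2)%N.
  rewrite -(size_scale B nm0); have -> : (n%:R - m%:R) *: B = (A - m%:R *: B) + (-1) *: (A - n%:R *: B).
    by rewrite scaleN1r opprB scalerBl; ring.
  exact: le2D.
by split=> //; rewrite -(subrK (m%:R *: B) A) le2D.
Qed.

Lemma moebius_sub (K : fieldType) (a b c d x y : K) :
  c * x + d != 0 -> c * y + d != 0 ->
  (a * x + b) / (c * x + d) - (a * y + b) / (c * y + d) =
  (a * d - b * c) * (x - y) / ((c * x + d) * (c * y + d)).
Proof. by move=> x0 y0; field; rewrite ?x0 ?y0. Qed.

Lemma moebius_ratio (K : fieldType) (D x y r s t : K) :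
  D != 0 -> y != 0 -> r != 0 -> s != 0 -> t != 0 ->
  t / s * (x / y) = D * x / (r * s) / (D * y / (r * t)).
Proof. by move=> D0 y0 r0 s0 t0; field; rewrite ?D0 ?y0 ?r0 ?s0 ?t0. Qed.

Lemma poly_size2 (F : nzRingType) (p : {poly F}) : (size p <= 2)%N ->
  p = (p`_1)%:P * 'X + (p`_0)%:P.
Proof.
move=> sp; apply/polyP => -[|[|i]]; rewrite coefD coefMX !coefC /= ?add0r ?addr0 //.
by rewrite nth_default // (leq_trans sp).
Qed.

(** * Substituting a fraction into a polynomial *)

Section Homogenize.
Variables (F : fieldType) (L : fieldType) (phi : {rmorphism {poly F} -> L}).

(** This is B^e p(A/B), written without division. *)
Definition homog e (p A B : {poly F}) := \sum_(j < e.+1) p`_j *: (A ^+ j * B ^+ (e - j)).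

Lemma rmorph_homog e (p A B : {poly F}) : phi B != 0 -> (size p <= e.+1)%N ->
  phi (homog e p A B) = (map_poly (phi \o polyC) p).[phi A / phi B] * phi B ^+ e.
Proof.
move=> B0 sp; rewrite (@horner_coef_wide _ e.+1); last first.
  by apply: leq_trans sp; apply: size_poly.
rewrite rmorph_sum mulr_suml /=; apply: eq_bigr => j _.
rewrite coef_map -mul_polyC !rmorphM !rmorphXn /= -mulrA; congr (_ * _).
rewrite expr_div_n -mulrA; congr (_ * _).
have -> : phi B ^+ e = phi B ^+ (e - j) * phi B ^+ j by rewrite -exprD subnK // leq_ord.
by rewrite mulrCA mulVf ?mulr1 // expf_neq0.
Qed.
End Homogenize.

Lemma horner_homog (F : fieldType) e (p A B : {poly F}) x : B.[x] != 0 -> (size p <= e.+1)%N ->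
  (homog e p A B).[x] = p.[A.[x] / B.[x]] * B.[x] ^+ e.
Proof.
move=> Bx sp; pose phi : {rmorphism {poly F} -> F} := [the {rmorphism {poly F} -> F} of horner_eval x].
have := @rmorph_homog F F phi e p A B Bx sp.
by rewrite map_poly_id // => c _; rewrite /= /horner_eval hornerC.
Qed.

(** * Functions whose conjugate is rational along a Zariski dense set [E] *)

Section Reflection.
Variable F : numClosedFieldType.
Variables (K : fieldType) (tau : {rmorphism {poly F} -> K}).
Variables (num den : K -> {poly F}).
Hypothesis tau_inj : injective tau.
Hypothesis den0 : forall f, den f != 0.
Hypothesis coprime_num_den : forall f, coprimep (num f) (den f).
Hypothesis numdenE : forall f, f = tau (num f) / tau (den f).
Variable E : F -> Prop.
Hypothesis denseE : forall k : {poly F}, k != 0 -> exists z, E z /\ k.[z] != 0.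
Implicit Types (f g V W : K) (p q k A B : {poly F}) (Q : F -> Prop).

Local Notation ratC := (ratC tau).
Local Notation ratconst := (ratconst tau).
Local Notation subfield := (subfield tau).

(** Almost everywhere on [E]; the exceptional roots absorb the poles, where [ev] takes the default
    value 0. *)
Definition ae Q := exists2 k, k != 0 & forall z, E z -> k.[z] != 0 -> Q z.

Definition ev f z := (num f).[z] / (den f).[z].

Lemma ae_forall Q : (forall z, Q z) -> ae Q.
Proof. by exists 1; rewrite ?oner_neq0. Qed.

Lemma ae2 Q1 Q2 Q : ae Q1 -> ae Q2 -> (forall z, Q1 z -> Q2 z -> Q z) -> ae Q.
Proof.
move=> [k1 k10 h1] [k2 k20 h2] h; exists (k1 * k2); first by rewrite mulf_neq0.
by move=> z Ez; rewrite hornerM mulf_eq0 negb_or => /andP[/(h1 z Ez) ? /(h2 z Ez)]; apply: h.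
Qed.

Lemma ae_and Q1 Q2 : ae Q1 -> ae Q2 -> ae (fun z => Q1 z /\ Q2 z).
Proof. by move=> h1 h2; apply: ae2 h1 h2 _. Qed.

Lemma ae1 Q1 Q : ae Q1 -> (forall z, Q1 z -> Q z) -> ae Q.
Proof. by move=> [k k0 h] hQ; exists k => // z Ez /(h z Ez)/hQ. Qed.

Lemma ae_exists Q : ae Q -> exists2 z, E z & Q z.
Proof. by move=> [k k0 h]; have [z [Ez kz]] := denseE k0; exists z => //; apply: h. Qed.

(** Any fraction representing [f] computes its value, as long as its denominator does not vanish
    there. *)
Lemma ev_frac f p q z : f * tau q = tau p -> q.[z] != 0 -> ev f z = p.[z] / q.[z].
Proof.
move=> Ef qz; have Epq : num f * q = p * den f.
  apply: tau_inj; rewrite !rmorphM /= -Ef mulrAC; congr (_ * _).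
  by rewrite {2}[f]numdenE mulfVK // (tau_eq0 tau_inj).
have Epqz : (num f).[z] * q.[z] = p.[z] * (den f).[z] by rewrite -!hornerM Epq.
have dz : (den f).[z] != 0.
  apply/eqP => dz; move/eqP: Epqz; rewrite dz mulr0 mulf_eq0 (negPf qz) orbF => /eqP nz.
  by have := coprimep_no_common (coprime_num_den f) nz; rewrite dz eqxx.
by rewrite /ev; apply/eqP; rewrite eqr_div // Epqz.
Qed.

Lemma den_tau0 f : tau (den f) != 0.
Proof. by rewrite (tau_eq0 tau_inj). Qed.

Lemma num_tau f : f * tau (den f) = tau (num f).
Proof. by rewrite {1}[f]numdenE mulfVK // den_tau0. Qed.

Lemma ev_const c z : ev (ratC c) z = c.
Proof.
have one z' : (1 : {poly F}).[z'] = 1 by rewrite -polyC1 hornerC.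
by rewrite (@ev_frac _ c%:P 1) ?one ?oner_neq0 ?hornerC ?divr1 // rmorph1 mulr1.
Qed.

Lemma ae_den2 f g Q : (forall z, (den f).[z] != 0 -> (den g).[z] != 0 -> Q z) -> ae Q.
Proof.
move=> h; exists (den f * den g); first by rewrite mulf_neq0.
by move=> z _; rewrite hornerM mulf_eq0 negb_or => /andP[]; apply: h.
Qed.

Lemma ae_evB f g : ae (fun z => ev (f - g) z = ev f z - ev g z).
Proof.
apply: (@ae_den2 f g) => z fz gz.
rewrite (@ev_frac _ (num f * den g - num g * den f) (den f * den g)).
- by rewrite !hornerE /ev; field; rewrite ?fz ?gz.
- by rewrite rmorphB !rmorphM /= -!num_tau; ring.
- by rewrite hornerM mulf_neq0.
Qed.

Lemma ae_evM f g : ae (fun z => ev (f * g) z = ev f z * ev g z).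
Proof.
apply: (@ae_den2 f g) => z fz gz.
rewrite (@ev_frac _ (num f * num g) (den f * den g)).
- by rewrite !hornerM /ev mulf_div.
- by rewrite !rmorphM /= -!num_tau; ring.
- by rewrite hornerM mulf_neq0.
Qed.

Lemma num_eq0 f : (num f == 0) = (f == 0).
Proof. by rewrite -(tau_eq0 tau_inj) -num_tau mulf_eq0 (negPf (den_tau0 f)) orbF. Qed.

Lemma ae_evV f : ae (fun z => ev f^-1 z = (ev f z)^-1).
Proof.
have [->|f0] := eqVneq f 0.
  apply: ae_forall => z; rewrite invr0 /ev.
  have /eqP -> : num 0 == 0 by rewrite num_eq0.
  by rewrite horner0 mul0r invr0.
exists (num f); first by rewrite num_eq0.
move=> z _ nz; rewrite (@ev_frac _ (den f) (num f)) //.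
  by rewrite /ev invf_div.
by rewrite -num_tau mulKf.
Qed.

Lemma ae_ev_neq0 f : f != 0 -> ae (fun z => ev f z != 0).
Proof.
move=> f0; exists (num f * den f); first by rewrite mulf_neq0 ?num_eq0.
move=> z _; rewrite hornerM mulf_eq0 negb_or /ev => /andP[nz dz].
by rewrite mulf_neq0 // invr_eq0.
Qed.

(** By density, a nonzero difference cannot vanish almost everywhere on [E]. *)
Lemma ae_ev_inj f g : ae (fun z => ev f z = ev g z) -> f = g.
Proof.
move=> fg; apply/eqP; rewrite -subr_eq0; apply/eqP/eqP; apply: contraT => /ae_ev_neq0 h.
have [z _ []] := ae_exists (ae_and (ae_and fg (ae_evB f g)) h).
by move=> [-> ->]; rewrite subrr eqxx.
Qed.

(* [crel f g] says that g is the conjugate of f along the curve E. *)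
Definition crel f g := ae (fun z => (ev f z)^* = ev g z).

Lemma crel_const c : crel (ratC c) (ratC c^*).
Proof. by apply: ae_forall => z; rewrite !ev_const. Qed.

Lemma crelB f f' g g' : crel f f' -> crel g g' -> crel (f - g) (f' - g').
Proof.
move=> hf hg; apply: ae2 (ae_and (ae_evB f g) hf) (ae_and (ae_evB f' g') hg) _.
by move=> z [-> e1] [-> e2]; rewrite rmorphB /= e1 e2.
Qed.

Lemma crelM f f' g g' : crel f f' -> crel g g' -> crel (f * g) (f' * g').
Proof.
move=> hf hg; apply: ae2 (ae_and (ae_evM f g) hf) (ae_and (ae_evM f' g') hg) _.
by move=> z [-> e1] [-> e2]; rewrite rmorphM /= e1 e2.
Qed.

Lemma crelV f f' : crel f f' -> crel f^-1 f'^-1.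
Proof.
move=> hf; apply: ae2 (ae_and (ae_evV f) hf) (ae_evV f') _.
by move=> z [-> e1] ->; rewrite fmorphV /= e1.
Qed.

Lemma crel_sym f g : crel f g -> crel g f.
Proof. by move=> fg; apply: ae1 fg _ => z <-; rewrite conjCK. Qed.

Lemma crel_inj f g g' : crel f g -> crel f g' -> g = g'.
Proof. by move=> fg fg'; apply: ae_ev_inj; apply: ae2 fg fg' _ => z <- <-. Qed.

(** The field S of the introductory comment. *)
Definition creflected f := exists g, crel f g.

Lemma subfield_creflected : subfield creflected.
Proof.
split=> [c|f g [f' ff'] [g' gg']|f g [f' ff'] [g' gg']|f [f' ff']].
- by exists (ratC c^*); apply: crel_const.
- by exists (f' - g'); apply: crelB.
- by exists (f' * g'); apply: crelM.
- by exists f'^-1; apply: crelV.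
Qed.

Definition rcomp p f := (map_poly ratC p).[f].

Lemma rcompMXaddC p c f : rcomp (p * 'X + c%:P) f = rcomp p f * f + ratC c.
Proof. by rewrite /rcomp rmorphD rmorphM /= map_polyX map_polyC hornerMXaddC. Qed.

Lemma rcompM p q f : rcomp (p * q) f = rcomp p f * rcomp q f.
Proof. by rewrite /rcomp rmorphM hornerM. Qed.

Lemma rcompD p q f : rcomp (p + q) f = rcomp p f + rcomp q f.
Proof. by rewrite /rcomp rmorphD hornerD. Qed.

Lemma rcompB p q f : rcomp (p - q) f = rcomp p f - rcomp q f.
Proof. by rewrite /rcomp rmorphB hornerD hornerN. Qed.

Lemma rcompC c f : rcomp c%:P f = ratC c.
Proof. by rewrite /rcomp map_polyC hornerC. Qed.

Lemma rcomp0 f : rcomp 0 f = 0.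
Proof. by rewrite /rcomp rmorph0 horner0. Qed.

Lemma rcomp1 f : rcomp 1 f = 1.
Proof. by rewrite /rcomp rmorph1 hornerC. Qed.

Lemma rcompX f : rcomp 'X f = f.
Proof. by rewrite /rcomp map_polyX hornerX. Qed.

Lemma crelD f f' g g' : crel f f' -> crel g g' -> crel (f + g) (f' + g').
Proof.
move=> hf hg; rewrite -[g]opprK -[g']opprK; apply: crelB => //.
rewrite -(sub0r g) -(sub0r g'); apply: crelB => //.
by have := crel_const 0; rewrite !rmorph0.
Qed.

Lemma crel_rcomp p f g : crel f g -> crel (rcomp p f) (rcomp (map_poly Num.conj p) g).
Proof.
move=> fg; elim/poly_ind: p => [|p c IH].
  by rewrite -polyC0 map_polyC !rcompC; apply: crel_const.
have -> : map_poly Num.conj (p * 'X + c%:P) = map_poly Num.conj p * 'X + (c^*)%:P.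
  by rewrite rmorphD rmorphM /= map_polyX map_polyC.
by rewrite !rcompMXaddC; apply: crelD; [apply: crelM|apply: crel_const].
Qed.

Lemma ae_evD f g : ae (fun z => ev (f + g) z = ev f z + ev g z).
Proof.
apply: (@ae_den2 f g) => z fz gz.
rewrite (@ev_frac _ (num f * den g + num g * den f) (den f * den g)).
- by rewrite !hornerE /ev; field; rewrite ?fz ?gz.
- by rewrite rmorphD !rmorphM /= -!num_tau; ring.
- by rewrite hornerM mulf_neq0.
Qed.

Lemma ae_ev_rcomp p f : ae (fun z => ev (rcomp p f) z = p.[ev f z]).
Proof.
elim/poly_ind: p => [|p c IH].
  by apply: ae_forall => z; rewrite -polyC0 rcompC hornerC ev_const.
rewrite rcompMXaddC.
apply: ae2 (ae_and IH (ae_evM (rcomp p f) f)) (ae_evD (rcomp p f * f) (ratC c)) _.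
by move=> z [e1 e2] ->; rewrite e2 e1 ev_const !hornerE.
Qed.

(** A nonconstant [f] is transcendental: [p] splits into linear factors, none of which vanishes at
    [f]. *)
Lemma rcomp_eq0 p f : ~ ratconst f -> rcomp p f = 0 -> p = 0.
Proof.
move=> fc; have [rs Ep] := closed_field_poly_normal p.
have prod0 : rcomp (\prod_(r <- rs) ('X - r%:P)) f != 0.
  elim: rs {Ep} => [|r rs IH]; first by rewrite big_nil rcomp1 oner_neq0.
  rewrite big_cons rcompM mulf_neq0 // -polyCN rcompD rcompX rcompC rmorphN.
  by rewrite subr_eq0; apply/eqP => Ef; apply: fc; exists r.
rewrite Ep -mul_polyC rcompM rcompC => /eqP.
by rewrite mulf_eq0 (negPf prod0) orbF fmorph_eq0 => /eqP ->; rewrite polyC0 mul0r.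
Qed.

(** Membership in the field generated by [V] over the constants. *)
Definition gen V f := exists A B, rcomp B V != 0 /\ f = rcomp A V / rcomp B V.

Lemma subfield_gen V : ~ ratconst V -> subfield (gen V).
Proof.
move=> Vc; have one0 : rcomp 1 V != 0 by rewrite rcomp1 oner_neq0.
have rcompN p : rcomp (- p) V = - rcomp p V by rewrite /rcomp rmorphN hornerN.
split=> [c|f g [A [B [B0 ->]]] [A' [B' [B'0 ->]]]|
  f g [A [B [B0 ->]]] [A' [B' [B'0 ->]]]|
  f [A [B [B0 ->]]]].
- by exists c%:P, 1; split; [exact: one0|rewrite rcomp1 divr1 rcompC].
- exists (A * B' - A' * B), (B * B'); rewrite rcompD rcompN !rcompM mulf_neq0 //; split=> //.
  by field; rewrite ?B0 ?B'0.
- exists (A * A'), (B * B'); rewrite !rcompM mulf_neq0 //; split=> //.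
  by rewrite mulf_div.
have [->|A0] := eqVneq (rcomp A V) 0.
  by exists 0, 1; split; rewrite // mul0r invr0 rcomp0 mul0r.
by exists B, A; rewrite invf_div.
Qed.

Lemma gen_self V : gen V V.
Proof.
by exists 'X, 1; rewrite rcompX rcomp1 divr1 oner_neq0.
Qed.

Lemma gen_coprime V f : ~ ratconst V -> gen V f ->
  exists A B, [/\ B != 0, coprimep A B & f = rcomp A V / rcomp B V].
Proof.
move=> Vc [A [B [BV ->]]].
have B0 : B != 0 by apply: contraNneq BV => ->; rewrite rcomp0.
have g0 : gcdp A B != 0 by rewrite gcdp_eq0 negb_and B0 orbT.
have gV : rcomp (gcdp A B) V != 0.
  by apply: contra_neq g0 => /(rcomp_eq0 Vc).
exists (A %/ gcdp A B), (B %/ gcdp A B); split.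
- by rewrite dvdp_div_eq0 ?dvdp_gcdr.
- by apply: coprimep_div_gcd; rewrite B0 orbT.
have EA : rcomp A V = rcomp (A %/ gcdp A B) V * rcomp (gcdp A B) V.
  by rewrite -rcompM divpK ?dvdp_gcdl.
have EB : rcomp B V = rcomp (B %/ gcdp A B) V * rcomp (gcdp A B) V.
  by rewrite -rcompM divpK ?dvdp_gcdr.
by rewrite EA EB -mulf_div divff // mulr1.
Qed.

Lemma moebius_nonconst f a b : ~ ratconst f -> a != b ->
  ~ ratconst ((f - ratC a) / (f - ratC b)) /\
  forall T, subfield T -> T ((f - ratC a) / (f - ratC b)) -> T f.
Proof.
move=> fc ab; have fb : f - ratC b != 0.
  by rewrite subr_eq0; apply/eqP => Ef; apply: fc; exists b.
set h := _ / _; have Eh : h * (f - ratC b) = f - ratC a by rewrite mulfVK.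
have h1 : 1 - h != 0.
  rewrite subr_eq0 eq_sym; apply: contra_neq ab => h1.
  move: Eh; rewrite h1 mul1r => /addrI/oppr_inj/fmorph_inj.
  by move=> ->.
have Ef : f = (ratC a - h * ratC b) / (1 - h).
  apply: (mulIf h1); rewrite divfK // mulrBr mulr1.
  have -> : ratC a = f - h * (f - ratC b) by rewrite Eh; ring.
  ring.
split=> [[c Ec]|T sT Th].
  apply: fc; exists ((a - c * b) / (1 - c)).
  by rewrite Ef Ec fmorph_div !rmorphB rmorphM rmorph1.
rewrite Ef; apply: (subfield_div sT); apply: (subfieldB sT) => //.
- exact: (subfield_const sT).
- by apply: (subfieldM sT) => //; apply: (subfield_const sT).
- exact: (subfield1 sT).
Qed.

(** Conjugating W' = A(W)/B(W) expresses [W] through [W'] by the conjugate polynomials. Hence A/B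
    has a rational inverse, and [size_moebius] applies. *)
Lemma creflected_moebius W W' : ~ ratconst W -> crel W W' -> gen W W' ->
  exists A B, [/\ rcomp B W != 0, W' = rcomp A W / rcomp B W,
    (size A <= 2)%N & (size B <= 2)%N].
Proof.
move=> Wc WW' genW'.
have W'c : ~ ratconst W'.
  move=> [c Ec]; apply: Wc; exists c^*.
  by apply: (crel_inj (crel_sym WW')); rewrite Ec; apply: crel_const.
have [A [B [B0 AB EW']]] := gen_coprime Wc genW'.
pose G := map_poly Num.conj A; pose H := map_poly Num.conj B.
have EW : W = rcomp G W' / rcomp H W'.
  apply: (crel_inj (crel_sym WW')); rewrite {1}EW'.
  by apply: crelM; [|apply: crelV]; apply: crel_rcomp.
have HW' : rcomp H W' != 0.
  by apply: contra_neq B0 => /(rcomp_eq0 W'c)/eqP; rewrite map_poly_eq0 => /eqP.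
have BW : rcomp B W != 0 by apply: contra_neq B0 => /(rcomp_eq0 Wc).
have GH : coprimep G H by rewrite coprimep_map.
suff [sA sB] : (size A <= 2)%N /\ (size B <= 2)%N by exists A, B.
apply: size_moebius AB GH _ => x Bx.
pose e := maxn (size G) (size H).
pose phi1 : {rmorphism {poly F} -> K} :=
  [the {rmorphism {poly F} -> K} of horner_eval W \o map_poly ratC].
have phi1E p : phi1 p = rcomp p W by [].
have phi1C p : map_poly (phi1 \o polyC) p = map_poly ratC p.
  by apply: eq_map_poly => c; rewrite /= map_polyC /= /horner_eval hornerC.
have eG : (size G <= e.+1)%N by rewrite leqW // leq_maxl.
have eH : (size H <= e.+1)%N by rewrite leqW // leq_maxr.
have e1 (p : {poly F}) : (size p <= e.+1)%N ->
    rcomp (homog e p A B) W = rcomp p W' * rcomp B W ^+ e.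
  by move=> sp; rewrite -phi1E (@rmorph_homog _ _ phi1 e p A B) // phi1C !phi1E -EW'.
(* The relation between [W] and [W'], with denominators cleared, is a polynomial identity because
   [W] is transcendental. *)
have : 'X * homog e H A B - homog e G A B = 0.
  apply: (rcomp_eq0 Wc); rewrite rcompB rcompM rcompX !e1 // mulrA.
  by rewrite {1}EW divfK // subrr.
move/(congr1 (fun p : {poly F} => p.[x])); rewrite horner0 hornerD hornerN hornerM hornerX.
rewrite !horner_homog // mulrA -mulrBl => /eqP.
by rewrite mulf_eq0 expf_eq0 (negPf Bx) andbF orbF subr_eq0 => /eqP.
Qed.

(** Lueroth's generator [W] is changed by Moebius transformations: first into [f], which conjugation
    multiplies by a constant, then into a real [g], then into a unimodular [V]. *)
Lemma unimodular_generator : (exists2 f, creflected f & ~ ratconst f) ->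
  exists V, [/\ ~ ratconst V, crel V V^-1 & forall f, creflected f -> gen V f].
Proof.
move=> hS; have sS := subfield_creflected.
have [W [SW Wc genW]] := luroth tau_inj den0 coprime_num_den numdenE sS hS.
have [W' WW'] := SW.
have W'c : ~ ratconst W'.
  move=> [c Ec]; apply: Wc; exists c^*.
  by apply: (crel_inj (crel_sym WW')); rewrite Ec; apply: crel_const.
have genW' : gen W W'.
  by apply: genW (subfield_gen Wc) (gen_self W) _ _; exists W; apply: crel_sym.
have [A [B [BW EW' sA sB]]] := creflected_moebius Wc WW' genW'.
have key : ae (fun z => B.[ev W z] != 0 /\ (ev W z)^* = A.[ev W z] / B.[ev W z]).
  have h1 := ae_and (ae_ev_rcomp A W) (ae_ev_rcomp B W).
  have h2 := ae_and (ae_evM (rcomp A W) (rcomp B W)^-1) (ae_evV (rcomp B W)).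
  have h3 := ae_and WW' (ae_ev_neq0 BW).
  apply: ae2 (ae_and h1 h2) h3 _.
  move=> z [[e1 e2] [e3 e4]] [-> e5]; split; first by rewrite -e2.
  by rewrite EW' e3 e4 e1 e2.
have [z0 _ []] := ae_exists key; set w0 := ev W z0 => Bw0 cw0.
have [z1 _ [[Bw1 cw1] w10]] : exists2 z, E z & (B.[ev W z] != 0 /\
    (ev W z)^* = A.[ev W z] / B.[ev W z]) /\ ev W z != w0.
  have Ww0 : W - ratC w0 != 0.
    by rewrite subr_eq0; apply/eqP => EW; apply: Wc; exists w0.
  have h := ae_and (ae_evB W (ratC w0)) (ae_ev_neq0 Ww0).
  apply: ae_exists; apply: ae2 key h _ => z kz [e1 e2]; split=> //.
  by move: e2; rewrite e1 ev_const subr_eq0.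
move: Bw1 cw1 w10; set w1 := ev W z1 => Bw1 cw1 w10.
have linear p : (size p <= 2)%N -> (forall w, p.[w] = p`_1 * w + p`_0) /\
    rcomp p W = ratC p`_1 * W + ratC p`_0.
  move=> sp; split=> [w|]; rewrite {1}(poly_size2 sp); first by rewrite !hornerE.
  by rewrite rcompMXaddC rcompC.
have [hA rA] := linear A sA; have [hB rB] := linear B sB.
set a := A`_1 in hA rA; set b := A`_0 in hA rA.
set c := B`_1 in hB rB; set d := B`_0 in hB rB.
pose D := ratC (a * d - b * c).
(* The Moebius transformation sends [w] to [w^*], so [W - w] divides the difference of the
   images. *)
have W'sub w : B.[w] != 0 -> w^* = A.[w] / B.[w] ->
    W' - ratC w^* = D * (W - ratC w) / (rcomp B W * ratC B.[w]).
  move=> Bw ->; rewrite EW' rA rB hA hB.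
  have Bw' : ratC c * ratC w + ratC d != 0.
    by rewrite -rmorphM -rmorphD fmorph_eq0 -hB.
  rewrite rB in BW; rewrite fmorph_div !rmorphD !rmorphM /=.
  by rewrite moebius_sub // /D rmorphB !rmorphM.
have W'0 w : W' - ratC w != 0.
  by rewrite subr_eq0; apply/eqP => Ew; apply: W'c; exists w.
have W0 w : W - ratC w != 0.
  by rewrite subr_eq0; apply/eqP => Ew; apply: Wc; exists w.
have D0 : D != 0.
  apply: contraNneq (W'0 w0^*) => D0.
  by rewrite W'sub // D0 !mul0r.
have w01 : w0 != w1 by rewrite eq_sym.
have [fc TW] := moebius_nonconst Wc w01.
set f := _ / _ in fc TW.
(* In the conjugate of the quotient [f], [D] and [rcomp B W] cancel, leaving this constant times
   [f]. *)
pose kappa := B.[w1] / B.[w0].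
have crf : crel f (ratC kappa * f).
  have -> : ratC kappa * f = (W' - ratC w0^*) / (W' - ratC w1^*).
    rewrite !W'sub // /f /kappa fmorph_div /=.
    have rw w : B.[w] != 0 -> ratC B.[w] != 0 by rewrite fmorph_eq0.
    by apply: moebius_ratio; [exact: D0|exact: W0|exact: BW|exact: rw|exact: rw].
  by apply: crelM; [|apply: crelV]; apply: crelB => //; apply: crel_const.
have f0 : f != 0 by apply: contra_not_neq fc => ->; exists 0; rewrite rmorph0.
(* Conjugation is applied twice. *)
have kk : kappa * kappa^* = 1.
  apply: (fmorph_inj ratC); apply: (mulIf f0); rewrite rmorph1 mul1r.
  have := crel_inj (crel_sym crf) (crelM (crel_const kappa) crf).
  by move=> {2}->; rewrite rmorphM mulrA [ratC _ * ratC _^*]mulrC.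
have [l0 lk] := unimodular_sqrt kk.
pose g := ratC (sqrtC kappa) * f.
have crg : crel g g.
  have := crelM (crel_const (sqrtC kappa)) crf.
  by rewrite mulrA -rmorphM lk.
have Tf T : subfield T -> T g -> T f.
  move=> sT Tg; have -> : f = ratC (sqrtC kappa)^-1 * g.
    by rewrite /g mulrA -rmorphM mulVf // rmorph1 mul1r.
  by apply: (subfieldM sT) => //; apply: (subfield_const sT).
have gc : ~ ratconst g.
  move=> [t Et]; apply: fc; exists ((sqrtC kappa)^-1 * t).
  by rewrite rmorphM -Et /g mulrA -rmorphM mulVf // rmorph1 mul1r.
(* The Cayley transformation (g - i)/(g + i) carries real values to the unit circle. *)
have i2 : 'i != - 'i :> F.
  by rewrite -addr_eq0 -mulr2n mulrn_eq0 /= (negPf (neq0Ci _)).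
have [Vc Tg] := moebius_nonconst gc i2.
set V := _ / _ in Vc Tg.
exists V; split=> //.
  have := crelM (crelB crg (crel_const 'i)) (crelV (crelB crg (crel_const (- 'i)))).
  have -> : V^-1 = (g - ratC (- 'i)) / (g - ratC 'i) by apply: invf_div.
  have e1 : ('i : F)^* = - 'i by apply: conjCi.
  have e2 : (- 'i : F)^* = 'i by rewrite rmorphN /= e1 opprK.
  by rewrite e1 e2.
move=> h Sh; have sV := subfield_gen Vc.
apply: (genW _ sV _ _ Sh); apply: (TW _ sV); apply: (Tf _ sV); apply: (Tg _ sV).
exact: gen_self.
Qed.

(** The points x are values of [V] along [E]; [k] is avoided because [rcomp k V] is a nonzero
    function. *)
Lemma unimodular_composite V f : ~ ratconst V -> crel V V^-1 -> f != 0 ->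
  crel f f^-1 -> gen V f ->
  exists A B, [/\ B != 0, coprimep A B, rcomp B V != 0, f = rcomp A V / rcomp B V &
    forall k, k != 0 -> exists x, [/\ k.[x] != 0, `|x| = 1 & `|A.[x]| = `|B.[x]|]].
Proof.
move=> Vc crV f0 crf genf; have [A [B [B0 AB Ef]]] := gen_coprime Vc genf.
have BV : rcomp B V != 0 by apply: contra_neq B0 => /(rcomp_eq0 Vc).
exists A, B; split=> // k k0.
have kV : rcomp k V != 0 by apply: contra_neq k0 => /(rcomp_eq0 Vc).
have V0 : V != 0 by apply: contra_not_neq Vc => ->; exists 0; rewrite rmorph0.
have unim h : h != 0 -> crel h h^-1 -> ae (fun z => `|ev h z| = 1).
  move=> h0 crh; apply: ae2 (ae_and crh (ae_evV h)) (ae_ev_neq0 h0) _.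
  move=> z [e1 e2] e3; apply/eqP; rewrite -sqrp_eq1 ?normr_ge0 //.
  by rewrite normCK e1 e2 mulfV.
have h1 := ae_and (ae_ev_rcomp A V) (ae_ev_rcomp B V).
have h2 := ae_and (ae_evM (rcomp A V) (rcomp B V)^-1) (ae_evV (rcomp B V)).
have h3 := ae_and (unim f f0 crf) (unim V V0 crV).
have h4 := ae_and (ae_ev_rcomp k V) (ae_ev_neq0 kV).
have h5 := ae_and h4 (ae_ev_neq0 BV).
have h6 := ae_and (ae_and h1 h2) (ae_and h3 h5).
have [z _ [[[e1 e2] [e3 e4]] [[e5 e6] [[e7 e8] e9]]]] := ae_exists h6.
exists (ev V z); rewrite -e7; split=> //.
move: e5; rewrite Ef e3 e4 e1 e2 normf_div => /eqP.
rewrite e2 in e9; rewrite (can2_eq (divfK _) (mulfK _)) ?normr_eq0 // mul1r.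
by move/eqP.
Qed.

End Reflection.

(** * Quotients of Blaschke products *)

Section Frac.
Variable F : fieldType.
Implicit Types p q : {poly F}.

Definition ratfrac p q : ratfun F := p%:F / q%:F.

Lemma tofrac_inj : injective (@FracField.tofrac {poly F}).
Proof. by move=> p q /eqP; rewrite tofrac_eq => /eqP. Qed.

Lemma frac_eq p q p' q' : q != 0 -> q' != 0 -> p * q' = p' * q -> ratfrac p q = ratfrac p' q'.
Proof.
move=> q0 q'0 E; apply/eqP; rewrite /ratfrac eqr_div ?tofrac_eq0 //.
by rewrite -!tofracM E.
Qed.

Lemma frac_mul p q p' q' : ratfrac p q * ratfrac p' q' = ratfrac (p * p') (q * q').
Proof. by rewrite /ratfrac !tofracM; apply: mulf_div. Qed.

Lemma frac_inv p q : (ratfrac p q)^-1 = ratfrac q p.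
Proof. exact: invf_div. Qed.

Lemma frac1 p : ratfrac p 1 = p%:F.
Proof. by rewrite /ratfrac tofrac1 divr1. Qed.
End Frac.

Lemma one_subZX_neq0 (F : nzRingType) (c : F) : 1 - c *: 'X != 0 :> {poly F}.
Proof.
apply/eqP => /(congr1 (fun p : {poly F} => p`_0)) /eqP.
by rewrite coefB coefZ coefX mulr0 subr0 coef1 coef0 /= oner_eq0.
Qed.

Section Blaschke.
Variable R : realType.
Local Notation C := R[i].
Implicit Types (Q : ratfun C) (A B k : {poly C}).

Lemma finite_blaschke_const (c : C) : `|c| = 1 -> finite_blaschke (c%:P)%:F.
Proof.
move=> c1; exists c, 0%N, (fun=> 0), (fun=> 1%N); split=> //.
- by move=> i; rewrite normr0 ltr01.
- by rewrite big_ord0 mulr1.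
Qed.

Lemma finite_blaschke1 : finite_blaschke (1 : ratfun C).
Proof.
have -> : (1 : ratfun C) = (1%:P)%:F by rewrite polyC1 tofrac1.
by apply: finite_blaschke_const; rewrite normr1.
Qed.

Lemma finite_blaschkeM Q1 Q2 :
  finite_blaschke Q1 -> finite_blaschke Q2 -> finite_blaschke (Q1 * Q2).
Proof.
move=> [c1 [n1 [a1 [m1 [c11 a11 m11 ->]]]]] [c2 [n2 [a2 [m2 [c21 a21 m21 ->]]]]].
pose a (i : 'I_(n1 + n2)) := match fintype.split i with inl j => a1 j | inr j => a2 j end.
pose m (i : 'I_(n1 + n2)) := match fintype.split i with inl j => m1 j | inr j => m2 j end.
exists (c1 * c2), (n1 + n2)%N, a, m; split.
- by rewrite normrM c11 c21 mulr1.
- by move=> i; rewrite /a; case: (fintype.split i).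
- by move=> i; rewrite /m; case: (fintype.split i).
rewrite big_split_ord polyCM tofracM mulrACA; congr (_ * (_ * _)).
  by apply: eq_bigr => j _; rewrite /a /m (unsplitK (inl j)).
by apply: eq_bigr => j _; rewrite /a /m (unsplitK (inr j)).
Qed.

Lemma finite_blaschke_factor (b : C) : `|b| < 1 -> finite_blaschke (blaschke_factor b).
Proof.
move=> b1; exists 1, 1%N, (fun=> b), (fun=> 1%N); split=> //; first exact: normr1.
by rewrite big_ord_recl big_ord0 expr1 mulr1 polyC1 tofrac1 mul1r.
Qed.

Lemma blaschke_quotientM Q1 Q2 :
  blaschke_quotient Q1 -> blaschke_quotient Q2 -> blaschke_quotient (Q1 * Q2).
Proof.
move=> [B1 [B1' [h1 h1' ->]]] [B2 [B2' [h2 h2' ->]]].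
exists (B1 * B2), (B1' * B2'); split; [exact: finite_blaschkeM..|exact: mulf_div].
Qed.

Lemma blaschke_quotientV Q : blaschke_quotient Q -> blaschke_quotient Q^-1.
Proof.
by move=> [B [B' [h h' ->]]]; exists B', B; split=> //; exact: invf_div.
Qed.

Lemma finite_blaschke_quotient Q : finite_blaschke Q -> blaschke_quotient Q.
Proof.
move=> h; exists Q, 1; split=> //; first exact: finite_blaschke1.
by rewrite divr1.
Qed.

(** |A| = |B| at infinitely many points of the unit circle. *)
Definition circle_dense A B := forall k, k != 0 ->
  exists x : C, [/\ k.[x] != 0, `|x| = 1 & `|A.[x]| = `|B.[x]|].

Lemma circle_dense_sym A B : circle_dense A B -> circle_dense B A.
Proof. by move=> h k /h[x [kx x1 e]]; exists x. Qed.

Lemma circle_conj (x : C) : `|x| = 1 -> x^*^-1 = x.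
Proof.
move=> x1; have xx : x * x^* = 1 by rewrite -normCK x1 expr1n.
have x0 : x^* != 0 by apply: contra_eq_neq xx => ->; rewrite mulr0 eq_sym oner_neq0.
by apply: (mulIf x0); rewrite mulVf.
Qed.

(** With p# the reflection of p in the circle, A A# - B B# vanishes at infinitely many points, hence
    identically. At [b] this leaves A A# = 0, and A(b) is nonzero by coprimality. *)
Lemma reflected_root A B (b : C) : coprimep A B -> circle_dense A B ->
  b != 0 -> root B b -> root A b^*^-1.
Proof.
move=> AB dense b0 rB; pose e := maxn (size A) (size B).
(* X^e times the conjugate polynomial at 1/X; a common e gives both reflections the same power of
   X. *)
pose sharp (p : {poly C}) := homog e (map_poly Num.conj p) 1 'X.
have sharpE (p : {poly C}) x : (size p <= e)%N -> x != 0 ->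
    (sharp p).[x] = (p.[x^*^-1])^* * x ^+ e.
  move=> sp x0; rewrite /sharp horner_homog ?hornerX //.
    by rewrite hornerC div1r -[x^-1]conjCK horner_map /= fmorphV.
  by rewrite (leq_trans (size_poly _ _)) // leqW.
have : A * sharp A - B * sharp B = 0.
  apply/eqP; apply: contraT => /dense[x [+ x1 EAB]].
  have x0 : x != 0 by rewrite -normr_eq0 x1 oner_neq0.
  rewrite !hornerE !sharpE ?leq_maxl ?leq_maxr // circle_conj // !mulrA -!normCK EAB.
  by rewrite subrr eqxx.
move/(congr1 (fun p : {poly C} => p.[b])); rewrite !hornerE (rootP rB) mul0r subr0.
rewrite sharpE ?leq_maxl // => /eqP; rewrite !mulf_eq0 expf_eq0 (negPf b0) andbF orbF.
have Ab : A.[b] != 0.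
  apply/eqP => Ab; have := coprimep_no_common AB Ab.
  by rewrite (rootP rB) eqxx.
by rewrite (negPf Ab) conjC_eq0.
Qed.

(** The pole [b] is split off with the zero 1/conj b. Up to a unimodular constant the pair is an
    inverse Blaschke factor if |b| < 1 and a Blaschke factor if |b| > 1; for b = 0 the partner is at
    infinity. *)
Lemma blaschke_step A B (b : C) : coprimep A B -> circle_dense A B ->
  A != 0 -> B != 0 -> root B b ->
  exists A1 B1 Q, [/\ blaschke_quotient Q, coprimep A1 B1, circle_dense A1 B1,
    (A1 != 0) && (B1 != 0) &
    ratfrac A B = Q * ratfrac A1 B1 /\ (size A1 + size B1 < size A + size B)%N].
Proof.
move=> AB dense A0 B0 rB; have [B1 EB] := factor_theorem _ _ rB.
have B10 : B1 != 0 by apply: contraNneq B0 => B10; rewrite EB B10 mul0r.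
have Xb : 'X - b%:P != 0 by rewrite polyXsubC_eq0.
have sB : size B = (size B1).+1 by rewrite EB size_Mmonic ?monicXsubC // size_XsubC addn2.
have coprimeB1 A1 : A1 %| A -> coprimep A1 B1.
  move=> dA; apply: (coprimep_dvdr dA); apply: coprimep_dvdl AB.
  by rewrite EB dvdp_mulIl.
have [b_eq0|b0] := eqVneq b 0.
  exists A, B1, (blaschke_factor b)^-1; split.
  - apply/blaschke_quotientV/finite_blaschke_quotient/finite_blaschke_factor.
    by rewrite b_eq0 normr0 ltr01.
  - exact: coprimeB1.
  - move=> k /dense[x [kx x1 E]]; exists x; split=> //.
    by rewrite E EB b_eq0 !hornerE subr0 normrM x1 mulr1.
  - by rewrite A0.
  split; last by rewrite sB addnS.
  rewrite -[blaschke_factor b]/(ratfrac _ _) frac_inv frac_mul b_eq0.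
  rewrite b_eq0 in EB Xb.
  apply: frac_eq => //; first by rewrite mulf_neq0.
  have -> : 1 - ((0 : C)^*)%C *: 'X = 1 :> {poly C} by rewrite conjc0 scale0r subr0.
  by rewrite mul1r EB; congr (_ * _); rewrite mulrC.
have rA := reflected_root AB dense b0 rB; set a := b^*^-1 in rA.
have b'0 : b^* != 0 by rewrite conjC_eq0.
have a'E : a^* = b^-1 by rewrite /a fmorphV /= conjCK.
(* On the circle [b] would be its own reflection, a common root of [A] and [B]. *)
have b1 : `|b| != 1.
  apply/eqP => /circle_conj Eb; move: rA; rewrite /a Eb => /rootP Ab.
  by move: (coprimep_no_common AB Ab); rewrite (rootP rB) eqxx.
have [A1 EA] := factor_theorem _ _ rA.
have A10 : A1 != 0 by apply: contraNneq A0 => A10; rewrite EA A10 mul0r.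
have sA : size A = (size A1).+1 by rewrite EA size_Mmonic ?monicXsubC // size_XsubC addn2.
(* The scalar [b] gives the split factor modulus 1 on the circle, since |x - a| = |x - b|/|b|
   there. *)
exists (b^-1 *: A1), B1, (ratfrac (b *: ('X - a%:P)) ('X - b%:P)); split.
- have [lt_b|ge_b] := boolP (`|b| < 1).
    have -> : ratfrac (b *: ('X - a%:P)) ('X - b%:P) =
        ((- (b / b^*))%:P)%:F * (blaschke_factor b)^-1.
      rewrite -[blaschke_factor b]/(ratfrac _ _) frac_inv -frac1 frac_mul mul1r.
      congr ratfrac; rewrite -!mul_polyC -[(b^*)%C]/(b^*).
      have E1 : (b / b^*)%:P * (b^*)%:P = b%:P by rewrite -polyCM divfK.
      have E2 : (b / b^*)%:P = b%:P * a%:P by rewrite -polyCM.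
      have -> : (- (b / b^*))%:P * (1 - (b^*)%:P * 'X) =
          - (b / b^*)%:P + (b / b^*)%:P * (b^*)%:P * 'X by rewrite polyCN; ring.
      by rewrite E1 E2; ring.
    apply: blaschke_quotientM.
      apply/finite_blaschke_quotient/finite_blaschke_const.
      by rewrite normrN normf_div norm_conjC divff ?normr_eq0.
    exact/blaschke_quotientV/finite_blaschke_quotient/finite_blaschke_factor.
  have gt_b : 1 < `|b|.
    by rewrite real_ltNge ?ger0_real ?normr_ge0 // le_eqVlt negb_or b1.
  have -> : ratfrac (b *: ('X - a%:P)) ('X - b%:P) = ((- 1)%:P)%:F * blaschke_factor a.
    rewrite -[blaschke_factor a]/(ratfrac _ _) -frac1 frac_mul mul1r.
    have n0 : 1 - a^* *: 'X != 0 by apply: one_subZX_neq0.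
    apply: frac_eq => //; rewrite -[(a^*)%C]/(a^*) a'E.
    rewrite -!mul_polyC mulrC mulrA mulrBl mul1r.
    have -> : (b^-1)%:P * 'X * b%:P = 'X by rewrite mulrAC -polyCM mulVf // mul1r.
    by rewrite polyCN; ring.
  apply: blaschke_quotientM.
    by apply/finite_blaschke_quotient/finite_blaschke_const; rewrite normrN normr1.
  apply/finite_blaschke_quotient/finite_blaschke_factor.
  by rewrite /a normfV norm_conjC invf_lt1 // normr_gt0.
- by apply: coprimeB1; rewrite dvdpZl ?invr_eq0 // EA dvdp_mulIl.
- move=> k /dense[x [kx x1 E]]; exists x; split=> //.
  have xb : `|x - b| != 0.
    rewrite normr_eq0 subr_eq0; apply: contraNneq b1 => <-; exact/eqP.
  apply: (mulIf xb); move: E; rewrite EA EB !hornerE !normrM => <-.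
  rewrite [RHS]mulrC -mulrA mulrCA [LHS]mulrC; congr (_ * _); rewrite mulrC.
  have -> : x - a = - (x * (x - b)^* / b^*).
    have xx : x * x^* = 1 by rewrite -normCK x1 expr1n.
    by rewrite rmorphB /= mulrBr xx mulrBl mul1r mulfK // opprB.
  by rewrite normrN normf_div normrM x1 mul1r !norm_conjC normfV.
- by rewrite scaler_eq0 invr_eq0 (negPf b0) A10.
split; last by rewrite size_scale ?invr_eq0 // sA sB addnS addSn ltnS leqnSn.
rewrite frac_mul; apply: frac_eq; rewrite ?mulf_neq0 // EA EB.
rewrite -scalerAl -scalerAr scalerA mulfV // scale1r; ring.
Qed.

(** [blaschke_step] removes the roots of [B]; those of [A] are removed after inverting the fraction.
    What remains is a constant of modulus 1. *)
Lemma blaschke_quotient_frac A B : coprimep A B -> circle_dense A B ->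
  A != 0 -> B != 0 -> blaschke_quotient (ratfrac A B).
Proof.
elim: (size A + size B)%N.+1 {-2}A {-2}B (ltnSn (size A + size B)) => // n IH {}A {}B.
rewrite ltnS => le_n AB dense A0 B0.
have step A' B' : (size A' + size B' <= n)%N -> coprimep A' B' -> circle_dense A' B' ->
    A' != 0 -> B' != 0 -> (1 < size B')%N -> blaschke_quotient (ratfrac A' B').
  move=> le_n' AB' dense' A'0 B'0 /nonconst_root[b rb].
  have [A1 [B1 [Q [bQ AB1 d1 /andP[A10 B10] [-> lt]]]]] :=
    blaschke_step AB' dense' A'0 B'0 rb.
  by apply: blaschke_quotientM => //; apply: IH => //; apply: leq_trans lt le_n'.
have [sB|sB] := leqP (size B) 1; last exact: step.
have [sA|sA] := leqP (size A) 1; last first.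
  rewrite -[ratfrac A B]invrK frac_inv; apply: blaschke_quotientV.
  by apply: step; rewrite ?(addnC (size B)) // 1?coprimep_sym //; apply: circle_dense_sym.
have EA := size1_polyC sA; have EB := size1_polyC sB.
move: EA EB; set a := A`_0; set b := B`_0 => EA EB.
have b0 : b != 0 by rewrite -polyC_eq0 -EB.
have -> : ratfrac A B = ((a / b)%:P)%:F.
  rewrite -frac1; apply: frac_eq; rewrite ?oner_neq0 // EA EB mulr1 -polyCM.
  by rewrite divfK.
apply/finite_blaschke_quotient/finite_blaschke_const.
have [x [_ _]] := dense 1 (oner_neq0 _).
by rewrite EA EB !hornerC normf_div => ->; rewrite divff ?normr_eq0.
Qed.

End Blaschke.

(** * Level curves of rational functions *)

(** The arithmetic-geometric mean inequality turns the product of 2 n_1 and 2 n_2 into the final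
    bound. *)
Lemma leq_mul_double m n : ((m + m) * (n + n) <= (m + n) ^ 2)%N.
Proof. by rewrite !addnn -!mul2n mulnACA nat_AGM2. Qed.

Lemma div_scale (K : fieldType) (c x y : K) : c != 0 -> x / y = c * x / (c * y).
Proof. by move=> c0; rewrite -mulf_div divff // mul1r. Qed.

(** * The abstract function field specialised to [ratfun] *)

Section Instance.
Variable R : realType.
Local Notation C := R[i].
Implicit Types (P V : ratfun C).
Local Notation tau := (@FracField.tofrac {poly C}).

Lemma rcomp_polycomp (p : {poly C}) V : rcomp tau p V = polycomp p V.
Proof. by []. Qed.

Lemma rateval_unimodular_neq0 P z : `|rateval P z| = 1 -> P != 0.
Proof.
apply: contra_eq_neq => ->; rewrite /rateval.
have /eqP -> : ratnum (0 : ratfun C) == 0.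
  by rewrite (num_eq0 (tau := tau) (@tofrac_inj C) (@ratden_neq0 C) (@ratfunE C)).
by rewrite horner0 mul0r normr0 eq_sym oner_neq0.
Qed.

Lemma unimodular_rel (E : C -> Prop) P :
  (forall z, E z -> `|rateval P z| = 1) -> crel (@ratnum _) (@ratden _) E P P^-1.
Proof.
move=> unim.
have [k k0 kP] := ae_evV (tau := tau) (@tofrac_inj C) (@ratden_neq0 C)
  (@coprimep_ratnum_ratden C) (@ratfunE C) E P.
exists k => // z Ez /(kP z Ez) ->; rewrite -[ev _ _ P z]/(rateval P z).
by rewrite -{2}(circle_conj (unim z Ez)) invrK.
Qed.

Lemma is_ratcomp_id P : is_ratcomp P P ('X%:F).
Proof.
have comp (p : {poly C}) : polycomp p ('X%:F) = p%:F by apply: (horner_lift tau).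
by split; rewrite !comp ?tofrac_eq0 ?ratden_neq0 //; apply: ratfunE.
Qed.

Lemma is_ratcomp_frac (A B : {poly C}) V : B != 0 -> coprimep A B ->
  polycomp B V != 0 -> is_ratcomp (polycomp A V / polycomp B V) (ratfrac A B) V.
Proof.
move=> B0 AB BV; have [c c0 [nE dE]] := ratnum_ratden_frac B0 AB.
have cV (p : {poly C}) : polycomp (c *: p) V = ratC tau c * polycomp p V.
  by rewrite -!rcomp_polycomp -mul_polyC rcompM rcompC.
have cK : ratC tau c != 0 by rewrite fmorph_eq0.
have nE' : ratnum (ratfrac A B) = c *: A by exact: nE.
have dE' : ratden (ratfrac A B) = c *: B by exact: dE.
rewrite /is_ratcomp nE' dE' (cV A) (cV B).
exact: (conj (mulf_neq0 cK BV) (div_scale _ _ cK)).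
Qed.

Lemma unimodular_decomposition (E : C -> Prop) (P1 P2 : ratfun C) :
  (forall k : {poly C}, k != 0 -> exists z, E z /\ k.[z] != 0) ->
  (forall z, E z -> `|rateval P1 z| = 1) -> (forall z, E z -> `|rateval P2 z| = 1) ->
  exists B1 B2 W : ratfun C,
    [/\ blaschke_quotient B1, blaschke_quotient B2, is_ratcomp P1 B1 W & is_ratcomp P2 B2 W].
Proof.
move=> dense h1 h2; have [z0 [Ez0 _]] := dense 1 (oner_neq0 _).
have P10 := rateval_unimodular_neq0 (h1 _ Ez0); have P20 := rateval_unimodular_neq0 (h2 _ Ez0).
have r1 := unimodular_rel h1; have r2 := unimodular_rel h2.
have [[f Sf fc]|const] := pselect (exists2 f, creflected (@ratnum _) (@ratden _) E f &
    ~ ratconst tau f).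
  have [|V [Vc rV genV]] := unimodular_generator (@tofrac_inj C) (@ratden_neq0 C)
    (@coprimep_ratnum_ratden C) (@ratfunE C) dense; first by exists f.
  have decomp P : P != 0 -> crel (@ratnum _) (@ratden _) E P P^-1 ->
      exists2 B, blaschke_quotient B & is_ratcomp P B V.
    move=> P0 rP; have genP : gen tau V P by apply: genV; exists P^-1.
    have [A [B [B0 AB BV EP dAB]]] := unimodular_composite (@tofrac_inj C) (@ratden_neq0 C)
      (@coprimep_ratnum_ratden C) (@ratfunE C) dense Vc rV P0 rP genP.
    exists (ratfrac A B); last by rewrite EP; apply: is_ratcomp_frac.
    apply: blaschke_quotient_frac => //.
    by apply: contra_neq P0 => A0; rewrite EP A0 rcomp0 mul0r.
  have [B1 bB1 c1] := decomp _ P10 r1; have [B2 bB2 c2] := decomp _ P20 r2.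
  by exists B1, B2, V.
(* If only constants have a rational conjugate, P1 and P2 are unimodular constants, and W is the
   identity. *)
have bconst P : crel (@ratnum _) (@ratden _) E P P^-1 ->
    `|rateval P z0| = 1 -> blaschke_quotient P.
  move=> rP; have [c ->] : ratconst tau P.
    by apply: contrapT => Pc; apply: const; exists P => //; exists P^-1.
  rewrite -[rateval _ _]/(ev (@ratnum _) (@ratden _) (ratC tau c) z0).
  rewrite (ev_const (@tofrac_inj C) (@ratden_neq0 C) (@coprimep_ratnum_ratden C) (@ratfunE C)).
  by move=> c1; apply/finite_blaschke_quotient/finite_blaschke_const.
by exists P1, P2, ('X%:F); split; [apply: bconst r1 _; apply: h1|apply: bconst r2 _; apply: h2|
  exact: is_ratcomp_id|exact: is_ratcomp_id].
Qed.

End Instance.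

Lemma card_le_seq (T : eqType) (E : set T) (s : seq T) n :
  (forall x, E x -> x \in s) -> (size s <= n)%N -> (E #<= `I_n)%card.
Proof.
move=> Es sn; have inj : {in E &, injective (index^~ s)}.
  move=> x y; rewrite !inE => /Es xs /Es ys eq_i.
  by rewrite -(nth_index x xs) /= eq_i nth_index.
rewrite -(card_le_eql (inj_card_eq inj)); apply: subset_card_le => _ [x /Es xs <-] /=.
by rewrite (leq_trans _ sn) // index_mem.
Qed.

(** * The polynomial that cuts out a level curve *)

Section LevelCurve.
Variable R : realType.
Local Notation C := R[i].
Implicit Types (p q k : {poly C}) (P : ratfun C) (z : C).

Definition levelpoly p q : {poly {poly C}} :=
  p%:P * (map_poly Num.conj p)^:P - q%:P * (map_poly Num.conj q)^:P.

Lemma horner_levelpoly p q z : (levelpoly p q).[z^*, z] = `|p.[z]| ^+ 2 - `|q.[z]| ^+ 2.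
Proof.
rewrite /levelpoly hornerD hornerN !hornerM !hornerC !horner_map /= hornerD hornerN !hornerM.
by rewrite !hornerC !normCK.
Qed.

Lemma planezero_levelpoly p q z : planezero (levelpoly p q) z = (`|p.[z]| == `|q.[z]|).
Proof. by rewrite /planezero horner_levelpoly subr_eq0 eqrXn2. Qed.

Lemma plane_real_levelpoly p q : plane_real (levelpoly p q).
Proof.
move=> z; rewrite horner_levelpoly; apply/eqP; rewrite -CrealE.
by rewrite rpredB // rpredX // normr_real.
Qed.

Lemma bideg_levelpoly p q n : (size p <= n.+1)%N -> (size q <= n.+1)%N ->
  (bideg (levelpoly p q) <= n + n)%N.
Proof.
move=> sp sq.
have szX (r : {poly C}) : (size (r%:P * (map_poly Num.conj r)^:P)%R <= size r)%N.
  rewrite mul_polyC (leq_trans (size_scale_leq _ _)) // size_map_polyC.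
  exact: size_poly.
have szY (r : {poly C}) : (sizeY (r%:P * (map_poly Num.conj r)^:P)%R <= size r)%N.
  rewrite sizeYE (rmorphM swapXY) /= swapXY_polyC swapXY_map_polyC mulrC mul_polyC.
  by rewrite (leq_trans (size_scale_leq _ _)) // size_map_polyC.
apply: leq_add; rewrite -subn1 leq_subLR add1n.
  rewrite (leq_trans (size_polyD _ _)) // size_polyN geq_max.
  by rewrite (leq_trans (szX p)) // (leq_trans (szX q)).
rewrite sizeYE /levelpoly (raddfB swapXY) (leq_trans (size_polyD _ _)) // size_polyN geq_max.
by rewrite -!sizeYE (leq_trans (szY p)) // (leq_trans (szY q)).
Qed.

(** At a root of p - cq with |c| < 1 one has |p| = |c||q| and q nonzero; c = 0 serves unless [p] is
    constant, and then c = 1/2 does. *)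
Lemma exists_norm_lt p q : coprimep p q -> (1 < maxn (size p) (size q))%N ->
  exists z, `|p.[z]| < `|q.[z]|.
Proof.
move=> pq nonconst.
have [c c1 sc] : exists2 c : C, `|c| < 1 & (1 < size (p - c *: q)%R)%N.
  have [sp|sp] := ltnP 1 (size p).
    by exists 0; rewrite ?normr0 ?ltr01 // scale0r subr0.
  have sq : (1 < size q)%N.
    by move: nonconst; rewrite leq_max ltnNge sp.
  exists 2^-1; first by rewrite normfV normr_nat invf_lt1 ?ltr1n.
  have h0 : 2^-1 != 0 :> C by rewrite invr_eq0 pnatr_eq0.
  by rewrite addrC size_polyDl size_polyN size_scale // (leq_ltn_trans sp).
have [z /rootP] := nonconst_root sc; rewrite hornerD hornerN hornerZ => /eqP.
rewrite subr_eq0 => /eqP pz; exists z; rewrite pz normrM.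
have qz : q.[z] != 0.
  apply/eqP => qz; have pz0 : p.[z] = 0 by rewrite pz qz mulr0.
  by have := coprimep_no_common pq pz0; rewrite qz eqxx.
by rewrite -[ltRHS]mul1r ltr_pM2r // normr_gt0.
Qed.

(** |p|^2 - |q|^2 takes both signs, which [no_sign_change] forbids if all its zeros are roots of
    [k]. *)
Lemma levelpoly_not_thin p q k : coprimep p q -> (1 < maxn (size p) (size q))%N ->
  k != 0 -> ~ (forall z, planezero (levelpoly p q) z -> root k z).
Proof.
move=> pq nonconst k0 thin.
have [A ltA] := exists_norm_lt pq nonconst.
have [B ltB] : exists z, `|q.[z]| < `|p.[z]|.
  by apply: exists_norm_lt; rewrite 1?coprimep_sym // maxnC.
have := no_sign_change A B (plane_real_levelpoly p q) k0 thin.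
rewrite leNgt => /negP; apply; rewrite nmulr_rlt0 -ltcR -plane_real_rc ?horner_levelpoly;
  by [exact: plane_real_levelpoly|rewrite ?subr_gt0 ?subr_lt0 ltrXn2r].
Qed.

Lemma levelpoly_neq0 p q : coprimep p q -> (1 < maxn (size p) (size q))%N -> levelpoly p q != 0.
Proof.
move=> pq nonconst; apply/eqP => F0; have [z] := exists_norm_lt pq nonconst.
have := horner_levelpoly p q z; rewrite F0 !horner0 => /esym/eqP.
by rewrite subr_eq0 eqrXn2 // => /eqP ->; rewrite ltxx.
Qed.

Local Notation levelP P := (levelpoly (ratnum P) (ratden P)).

(** Poles cause no discrepancy: [rateval] is 0 there, and coprimality makes the numerator nonzero
    where the denominator vanishes. *)
Lemma rateval_unimodular P z : `|rateval P z| = 1 <-> planezero (levelP P) z.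
Proof.
rewrite planezero_levelpoly /rateval normf_div; split=> [E|/eqP E].
  have [d0|d0] := eqVneq `|(ratden P).[z]| 0.
    by move: E; rewrite d0 invr0 mulr0 => /esym/eqP; rewrite oner_eq0.
  by rewrite -(divfK d0 `|_|) E mul1r.
have d0 : (ratden P).[z] != 0.
  apply/eqP => d0; move: E; rewrite d0 normr0 => /normr0_eq0 n0.
  by have := coprimep_no_common (coprimep_ratnum_ratden P) n0; rewrite d0 eqxx.
by rewrite E divff // normr_eq0.
Qed.

Lemma ratdeg_gt0 P : (0 < ratdeg P)%N -> (1 < maxn (size (ratnum P)) (size (ratden P)))%N.
Proof. by rewrite /ratdeg !leq_max -!subn1 !subn_gt0. Qed.

Lemma ratdeg_eq0 P : ratdeg P = 0%N -> exists c, forall z, rateval P z = c.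
Proof.
move/eqP; rewrite -leqn0 geq_max -!subn1 !leq_subLR addn0 => /andP[sn sd].
exists ((ratnum P)`_0 / (ratden P)`_0) => z.
by rewrite /rateval (size1_polyC sn) (size1_polyC sd) !hornerC !coefC.
Qed.

(** For constant [P] the set would be the whole level set of [P'], which is infinite or
    everything. *)
Lemma thin_ratdeg_gt0 P P' k z0 : k != 0 ->
  (forall z, `|rateval P z| = 1 -> `|rateval P' z| = 1 -> root k z) ->
  `|rateval P z0| = 1 -> `|rateval P' z0| = 1 -> (0 < ratdeg P)%N.
Proof.
move=> k0 thin Pz0 P'z0; rewrite lt0n; apply/eqP => /ratdeg_eq0[c Pc].
have thin' z : `|rateval P' z| = 1 -> root k z.
  by apply: thin; rewrite Pc -(Pc z0).
have [/ratdeg_eq0[c' P'c]|/ratdeg_gt0 degP'] := posnP (ratdeg P').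
  have [z /negP] := outside_root k0; apply; apply: thin'.
  by rewrite P'c -(P'c z0).
apply: (levelpoly_not_thin (coprimep_ratnum_ratden P') degP' k0) => z.
by move/rateval_unimodular/thin'.
Qed.

End LevelCurve.

Local Open Scope classical_set_scope.
Local Open Scope card_scope.

Theorem theorem2p2 (R : realType) (P1 P2 : ratfun R[i]) (n1 n2 : nat)
  (hn1 : ratdeg P1 = n1) (hn2 : ratdeg P2 = n2) :
  ~ (exists B1 B2 W : ratfun R[i],
       [/\ blaschke_quotient B1, blaschke_quotient B2,
           is_ratcomp P1 B1 W & is_ratcomp P2 B2 W]) ->
  [set z : R[i] | `|rateval P1 z| = 1 /\ `|rateval P2 z| = 1]
    #<= `I_((n1 + n2) ^ 2).
Proof.
move=> indecomposable; set E := [set z | _].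
(* Otherwise [E] is Zariski dense and [unimodular_decomposition] gives the excluded
   decomposition. *)
have [k k0 thin] : exists2 k : {poly R[i]}, k != 0 & forall z, E z -> root k z.
  apply: contrapT => dense; apply: indecomposable.
  apply: (@unimodular_decomposition R E) => [k k0|z []|z []] //.
  apply: contrapT => none; apply: dense; exists k => // z Ez; apply/rootP/eqP.
  by apply: contrapT => /negP kz; apply: none; exists z.
have [rs Ek] := closed_field_poly_normal k.
pose s := [seq z <- undup rs | `[< E z >]].
apply: (@card_le_seq _ E s) => [z Ez|].
  rewrite mem_filter mem_undup; apply/andP; split; first exact/asboolP.
  by have := thin z Ez; rewrite Ek rootZ ?lead_coef_eq0 // root_prod_XsubC.
have us : uniq s by rewrite filter_uniq ?undup_uniq.
have sE z : z \in s -> E z by rewrite mem_filter => /andP[/asboolP].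
(* A point of [E] is needed to show that both degrees are positive; without one the bound is
   trivial. *)
have [s0|[z0 /sE [E1 E2]]] : s = [::] \/ exists z, z \in s.
  by case: s {us sE} => [|z s]; [left|right; exists z; rewrite mem_head].
  by rewrite s0.
have deg1 : (0 < ratdeg P1)%N.
  by apply: (thin_ratdeg_gt0 k0 _ E1 E2) => z *; apply: thin.
have deg2 : (0 < ratdeg P2)%N.
  by apply: (thin_ratdeg_gt0 k0 _ E2 E1) => z *; apply: thin.
have size_max (P : ratfun R[i]) :
    (size (ratnum P) <= (ratdeg P).+1)%N /\ (size (ratden P) <= (ratdeg P).+1)%N.
  rewrite /ratdeg; split; apply: leq_trans (leqSpred _) _; rewrite ltnS.
    exact: leq_maxl.
  exact: leq_maxr.
pose F (P : ratfun R[i]) := levelpoly (ratnum P) (ratden P).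
have F0 P : (0 < ratdeg P)%N -> F P != 0.
  by move/ratdeg_gt0; apply: levelpoly_neq0; apply: coprimep_ratnum_ratden.
have bF P : (bideg (F P) <= ratdeg P + ratdeg P)%N.
  by have [sn sd] := size_max P; apply: bideg_levelpoly.
apply: (@leq_trans (bideg (F P1) * bideg (F P2))).
  apply: (common_planezero_card (F0 _ deg1) (F0 _ deg2) k0) => //.
  - by move=> z /rateval_unimodular z1 /rateval_unimodular z2; apply: thin.
  - by apply/allP => z /sE[/rateval_unimodular].
  - by apply/allP => z /sE[_ /rateval_unimodular].
rewrite -hn1 -hn2; apply: leq_trans (leq_mul (bF P1) (bF P2)) _.
exact: leq_mul_double.
Qed.
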